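(* Let $\varpi$ be a probability distribution with support $\mathsf{X}\times\mathsf{Y}\subseteq\mathbb{R}^k\times\mathbb{R}^l$, let $p\in(0,1)$, and let $\Phi_X$, $\Phi_{DGS}$, $\Phi_{RGS}$ be the associated marginal chain, deterministic scan Gibbs sampler and random scan Gibbs sampler (with selection probability $p$), with Markov kernels $P_X$, $P_{DGS}$, $P_{RGS}$. Suppose there exists a sequence $\{h_i\}_{i\ge1}$ with $h_i\in L^2_{0,1}(\varpi_X)$ such that if $(X,Y)\sim\varpi$, then $$\liminf_{i\to\infty}E\left[\mathrm{Var}(h_i(X)\mid Y)\right]=0.$$ Then $\|P_X\|=\|P_{RGS}\|=1$. Hence $\Phi_X$, $\Phi_{RGS}$ and $\Phi_{DGS}$ are subgeometrically ergodic.
   Context: Setting. $\varpi$ is a probability distribution having support $\mathsf{X}\times\mathsf{Y}\subseteq\mathbb{R}^k\times\mathbb{R}^l$, $k,l\ge1$, with density $\pi(x,y)$ with respect to a product measure $\mu=\mu_X\times\mu_Y$. The marginal densities are $\pi_X(x)=\int_{\mathsf{Y}}\pi(x,y)\mu_Y(dy)$ and $\pi_Y(y)=\int_{\mathsf{X}}\pi(x,y)\mu_X(dx)$, and the conditional densities are $\pi_{X|Y}(x|y)=\pi(x,y)/\pi_Y(y)$ and $\pi_{Y|X}(y|x)=\pi(x,y)/\pi_X(x)$; these are understood to be well defined for all $x\in\mathsf{X}$, $y\in\mathsf{Y}$. $\varpi_X$ denotes the $X$-marginal of $\varpi$. Kernels. $P_{DGS}((x,y),A)=\int_A\pi_{X|Y}(x'|y)\pi_{Y|X}(y'|x')\,\mu(d(x',y'))$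 on $\mathsf{X}\times\mathsf{Y}$. $P_X(x,A)=\int_A k_X(x'|x)\mu_X(dx')$ on $\mathsf{X}$, where $k_X(x'|x)=\int_{\mathsf{Y}}\pi_{X|Y}(x'|y)\pi_{Y|X}(y|x)\mu_Y(dy)$. For fixed $p\in(0,1)$, $P_{RGS}((x,y),A)=p\int 1_A(x',y)\pi_{X|Y}(x'|y)\mu_X(dx')+(1-p)\int 1_A(x,y')\pi_{Y|X}(y'|x)\mu_Y(dy')$. The invariant distributions are $\varpi$ for $P_{DGS}$ and $P_{RGS}$, and $\varpi_X$ for $P_X$. $\Phi_X,\Phi_{DGS},\Phi_{RGS}$ are the corresponding Markov chains. Definitions. For a probability measure $w$, $L^2_{0,1}(w)=\{f\in L^2(w):E_wf=0,\ E_wf^2=1\}$ (real-valued functions). For a Markov kernel $P$ with invariant probability measure $w$, $Pf(z)=\int f(z')P(z,dz')$ and $\|P\|=\sup_{f\in L^2_{0,1}(w)}\|Pf\|$, where $\|f\|^2=\int f^2\,dw$; thus $\|P_X\|$ is computed over $L^2_{0,1}(\varpi_X)$ and $\|P_{RGS}\|$ over $L^2_{0,1}(\varpi)$. A chain on $\mathsf{Z}$ with kernel $P$ and invariant probability $w$ is geometrically ergodic if there exist a real-valued function $M$ on $\mathsf{Z}$ and $0<t<1$ such that $\|P^n(z,\cdot)-w(\cdot)\|_{TV}\le M(z)t^n$ for all $z\in\mathsf{Z}$ and all $n$; otherwise it is called subgeometrically ergodic. *)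

(* Defs.v *)
From HB Require Import structures.
From mathcomp Require Import all_boot all_order all_algebra.
From mathcomp Require Import all_classical all_reals all_analysis.

Set Implicit Arguments.
Unset Strict Implicit.
Unset Printing Implicit Defensive.

Import Order.TTheory GRing.Theory Num.Theory.
Import numFieldNormedType.Exports.

Local Open Scope classical_set_scope.
Local Open Scope ring_scope.
Local Open Scope ereal_scope.

Section markov_kernels.
Context d (T : measurableType d) (R : realType).
Implicit Types (w : probability T R) (P : T -> set T -> \bar R).

Definition L2_01 w : set (T -> R) :=
  [set f | [/\ f \in Lfun w 2%:E, 'E_w[f] = 0 & 'E_w[f ^+ 2] = 1]].

(* A Markov kernel is given by its transition function z, A |-> P z A. *)
Definition kernel_act P (f : T -> R) (z : T) : \bar R :=
  \int[P z]_u (f u)%:E.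

Definition kernel_norm w P : \bar R :=
  ereal_sup [set 'N[w]_2%:E[kernel_act P f] | f in L2_01 w].

Fixpoint kernel_iter P (n : nat) (z : T) (A : set T) : \bar R :=
  if n is m.+1 then \int[P z]_u kernel_iter P m u A else \d_z A.

(* Other normalisations of the total variation distance differ by a factor 2,
   which the function M below absorbs. *)
Definition tv_dist (m1 m2 : set T -> \bar R) : \bar R :=
  ereal_sup [set `|m1 A - m2 A| | A in measurable].

(* The state space is a subset Z of T; values of P outside Z are irrelevant
   as soon as P z and w are concentrated on Z for all z in Z. *)
Definition geometrically_ergodic (Z : set T) w P : Prop :=
  exists (M : T -> R) (t : R), (0 < t < 1)%R /\
    forall z, Z z -> forall n,
      tv_dist (kernel_iter P n z) w <= (M z * t ^+ n)%:E.

Definition subgeometrically_ergodic (Z : set T) w P : Prop :=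
  ~ geometrically_ergodic Z w P.

End markov_kernels.

Section fst_measurable.
Context d1 d2 (T1 : measurableType d1) (T2 : measurableType d2).

HB.instance Definition _ := isMeasurableFun.Build _ _ _ _
  (@fst T1 T2) measurable_fst.

End fst_measurable.

Section gibbs.
Context d1 d2 (T1 : measurableType d1) (T2 : measurableType d2) (R : realType).
Variables (X : set T1) (Y : set T2).
Variables (muX : {sigma_finite_measure set T1 -> \bar R})
          (muY : {sigma_finite_measure set T2 -> \bar R}).
Variable dens : T1 * T2 -> R.

Definition marginalX (x : T1) : \bar R := \int[muY]_(y in Y) (dens (x, y))%:E.
Definition marginalY (y : T2) : \bar R := \int[muX]_(x in X) (dens (x, y))%:E.

(* condX x y is the density of X at x given Y = y, and condY y x that of Y at y
   given X = x; [fine] is harmless where the marginals lie in ]0, +oo[. *)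
Definition condX (x : T1) (y : T2) : R := (dens (x, y) / fine (marginalY y))%R.
Definition condY (y : T2) (x : T1) : R := (dens (x, y) / fine (marginalX x))%R.

Definition PDGS (z : T1 * T2) (A : set (T1 * T2)) : \bar R :=
  \int[muX \x muY]_(z' in A `&` (X `*` Y))
    (condX z'.1 z.2 * condY z'.2 z'.1)%:E.

(* kX x' x is the transition density from x to x'. *)
Definition kX (x' x : T1) : \bar R :=
  \int[muY]_(y in Y) (condX x' y * condY y x)%:E.

Definition PX (x : T1) (A : set T1) : \bar R :=
  \int[muX]_(x' in A `&` X) kX x' x.

Definition PRGS (p : R) (z : T1 * T2) (A : set (T1 * T2)) : \bar R :=
  p%:E * (\int[muX]_(x' in X) (\1_A (x', z.2) * condX x' z.2)%:E) +
  (1 - p)%:E * (\int[muY]_(y' in Y) (\1_A (z.1, y') * condY y' z.1)%:E).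

(* Conditional mean and variance of h(X) given Y = y; outside Y the value is
   irrelevant. *)
Definition cond_mean (h : T1 -> R) (y : T2) : \bar R :=
  \int[muX]_(x in X) (h x * condX x y)%:E.

Definition cond_var (h : T1 -> R) (y : T2) : \bar R :=
  \int[muX]_(x in X) ((h x - fine (cond_mean h y)) ^+ 2 * condX x y)%:E.

End gibbs.

(* Main.v *)
(* The Dirichlet form of h(X) under P_X and under P_RGS is at most
   4 E[Var(h(X) | Y)], so the hypothesis makes it arbitrarily small on unit
   vectors; then |P h| is arbitrarily close to |h| = 1.

   Geometric ergodicity of a reversible kernel P would entail a Poincare
   inequality, which such h violate.  Indeed, let f be bounded and vanish
   outside {M <= m}.  Then <f - E f, P^n (f - E f)> = O(t^n), and since
   n |-> |P^n (f - E f)|^2 is log-convex, its rate of decay bounds its first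
   ratio: |P (f - E f)| <= t |f - E f|.  These f are dense in L^2; as M need
   not be measurable, {M <= m} is replaced by a measurable hull.

   P_DGS is not reversible, but its Y-coordinate is a reversible chain, which
   inherits geometric ergodicity; the functions m(y) = E[h(X) | Y = y] violate
   the Poincare inequality of that chain. *)

Require Import Defs.
From HB Require Import structures.
From mathcomp Require Import all_boot all_order all_algebra.
From mathcomp Require Import all_classical all_reals all_analysis.
From mathcomp Require Import measurable_realfun ring lra.

Set Implicit Arguments.
Unset Strict Implicit.
Unset Printing Implicit Defensive.

Import Order.TTheory GRing.Theory Num.Theory.
Import numFieldNormedType.Exports.

Local Open Scope classical_set_scope.
Local Open Scope ring_scope.
Local Open Scope ereal_scope.

(** * Reversible Markov kernels *)

(** The Dirichlet form is a double integral of a nonnegative function. It therefore makes sense for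
    every measurable [f], and Tonelli's theorem carries the estimates for the concrete kernels. The
    operator [kernel_op] is applied to bounded functions only, whose iterates are again bounded and
    defined everywhere. The factor 4 comes from (a - b)^2 <= 2 (a - m)^2 + 2 (b - m)^2: given Y = y,
    the values of X before and after an update are independent with the same law, so both terms have
    the same mean. What the hypothesis makes small is E (h(X) - m(Y))^2. This treats the two
    coordinates alike, which is why m serves as test function for the Y-chain. The transition
    functions are prescribed at all starting points, although the conditional densities are
    meaningful only on X and Y. Cutting the densities off makes the reversible kernels measures of
    mass at most 1 everywhere and of mass 1 on the state space, hence almost everywhere; the general
    results ask for no more than this of the mass. *)

Section density.
Context d (T : measurableType d) (R : realType).
Variables (mu : {measure set T -> \bar R}) (rho : T -> \bar R).
Hypotheses (rho0 : forall x, 0 <= rho x) (mrho : measurable_fun setT rho).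

(* The unused proofs let the measure structure be inferred. *)
Definition mdens (_ : forall x, 0 <= rho x) (_ : measurable_fun setT rho)
  (A : set T) : \bar R := \int[mu]_(x in A) rho x.

Local Notation md := (mdens rho0 mrho).

Let mdens0 : md set0 = 0. Proof. exact: integral_set0. Qed.

Let mdens_ge0 A : 0 <= md A. Proof. exact: integral_ge0. Qed.

Let mdens_sigma_additive : semi_sigma_additive md.
Proof.
move=> /= F mF tF mUF; rewrite /mdens; apply: cvg_toP.
  apply: ereal_nondecreasing_is_cvgn => m n mn.
  by apply: lee_sum_nneg_natr => // k _ _; exact: integral_ge0.
by rewrite ge0_integral_bigcup//; exact: measurable_funTS.
Qed.

HB.instance Definition _ := isMeasure.Build _ _ _ md
  mdens0 mdens_ge0 mdens_sigma_additive.

Import HBNNSimple.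

(** Monotone convergence along simple functions reduces the formula to indicators, where it is [mE].
    The measure [m] is only assumed to agree with the density on measurable sets, so that both
    [mdens] and a given probability with a density are covered. *)
Lemma ge0_integral_density (m : {measure set T -> \bar R}) (f : T -> \bar R) :
  (forall A, measurable A -> m A = \int[mu]_(x in A) rho x) ->
  (forall x, 0 <= f x) -> measurable_fun setT f ->
  \int[m]_x f x = \int[mu]_x (f x * rho x).
Proof.
move=> mE f0 mf; pose h := nnsfun_approx measurableT mf.
have fE x : f x = limn (fun n => (h n x)%:E).
  by apply/esym/cvg_lim => //; apply: cvg_nnsfun_approx.
have hndecr x : nondecreasing_seq (fun n => (h n x)%:E).
  by move=> a b ab; rewrite lee_fin; exact/lefP/nd_nnsfun_approx.
have -> : \int[m]_x f x = limn (fun n => \int[m]_x (h n x)%:E).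
  rewrite -monotone_convergence//.
  - by apply: eq_integral => x _.
  - by move=> n; exact/measurable_EFinP.
  - by move=> n x _; rewrite lee_fin.
have -> : \int[mu]_x (f x * rho x) = limn (fun n => \int[mu]_x ((h n x)%:E * rho x)).
  rewrite -monotone_convergence//.
  - apply: eq_integral => x _; rewrite fE; apply/esym/cvg_lim => //.
    (* [rho x] may be infinite, so the limit of the products is taken after excluding the form
       [0 * +oo]: if [f x = 0], all approximants vanish at [x]. *)
    have [fx0|fx0] := eqVneq (f x) 0.
      rewrite -fE fx0 mul0e; apply: cvg_near_cst; apply: nearW => n.
      suff -> : h n x = 0%R by rewrite mul0e.
      apply/eqP; rewrite eq_le -!lee_fin -[X in (_ <= X)%E]fx0.
      by rewrite /h nnsfun_approxE le_approx//= lee_fin -nnsfun_approxE.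
    have [->|rx0] := eqVneq (rho x) 0.
      by under eq_fun do rewrite mule0; rewrite mule0; exact: cvg_cst.
    apply: cvgeM; [|rewrite -fE; exact: cvg_nnsfun_approx|exact: cvg_cst].
    by rewrite -fE; apply: neq0_mule_def; rewrite mule_eq0 negb_or fx0.
  - by move=> n; apply: emeasurable_funM => //; exact/measurable_EFinP.
  - by move=> n x _; rewrite mule_ge0 ?lee_fin.
  - by move=> x _ a b ab; rewrite lee_wpmul2r// hndecr.
congr (limn _); apply/funext => n.
under eq_integral do rewrite fimfunE -fsumEFin//.
rewrite ge0_integral_fsum//; last 2 first.
  - by move=> r; exact/measurable_EFinP/measurableT_comp.
  - by move=> r x _; rewrite EFinM nnfun_muleindic_ge0.
under [RHS]eq_integral => x _.
  rewrite fimfunE -fsumEFin// muleC ge0_mule_fsumr; last first.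
    by move=> r; rewrite EFinM nnfun_muleindic_ge0.
  over.
rewrite [RHS]ge0_integral_fsum//; last 2 first.
  - move=> r; apply: emeasurable_funM => //.
    by apply/measurable_EFinP; apply/measurableT_comp => //.
  - by move=> r x _; rewrite mule_ge0// EFinM nnfun_muleindic_ge0.
apply: eq_fsbigr => r _.
rewrite integralZl_indic_nnsfun// integral_indic// setIT mE//.
have [r0|r0] := leP 0%R r; last first.
  rewrite preimage_nnfun0// integral_set0 mule0.
  by under eq_integral do rewrite indic0 mulr0 mule0; rewrite integral0.
rewrite -ge0_integralZl//; last exact: measurable_funTS.
rewrite [LHS]integral_mkcond; apply: eq_integral => x _.
rewrite patchE indicE; case: ifPn => _.
  by rewrite mulr1 muleC.
by rewrite mulr0 mule0.
Qed.

End density.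

Section measurable_projections.
Context d1 d2 d3 (T1 : measurableType d1) (T2 : measurableType d2)
  (T3 : measurableType d3).

Lemma measurable_fun_fst (f : T1 -> T3) : measurable_fun setT f ->
  measurable_fun setT (fun p : T1 * T2 => f p.1).
Proof. by move=> mf; apply: (measurableT_comp (f := f)). Qed.

Lemma measurable_fun_snd (f : T2 -> T3) : measurable_fun setT f ->
  measurable_fun setT (fun p : T1 * T2 => f p.2).
Proof. by move=> mf; apply: (measurableT_comp (f := f)). Qed.

Lemma measurable_fun_pairl (f : T1 * T2 -> T3) (x : T1) : measurable_fun setT f ->
  measurable_fun setT (fun y => f (x, y)).
Proof. by move=> mf; apply: (measurableT_comp (f := f)). Qed.

Lemma measurable_fun_swap (f : T1 * T2 -> T3) : measurable_fun setT f ->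
  measurable_fun setT (fun p : T2 * T1 => f (p.2, p.1)).
Proof.
move=> mf; apply: (measurableT_comp (f := f)) => //.
exact: measurable_swap.
Qed.

End measurable_projections.

(** * Measurable hulls of arbitrary sets *)

Section measurable_hull.
Context d (T : measurableType d) (R : realType) (w : probability T R).

(** The infimum of [w] over measurable supersets of [S] is attained by a countable intersection [E]
    of near-minimisers. For measurable [B] containing [S], the intersection of [E] and [B] is still
    a competitor, so it has at least the mass of [E]. *)
Lemma measurable_hull (S : set T) : exists E, [/\ measurable E, S `<=` E &
  forall B, measurable B -> S `<=` B -> w (E `\` B) = 0].
Proof.
pose V := [set fine (w B) | B in [set B | measurable B /\ S `<=` B]].
have V1 : has_inf V.
  split; first by exists (fine (w setT)); exists setT.
  by exists 0%R => _ [B [mB _] <-]; rewrite fine_ge0.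
have wfin B : measurable B -> w B = (fine (w B))%:E.
  by move=> mB; rewrite fineK// fin_num_measure.
have /choice[B BP] n : exists B, [/\ measurable B, S `<=` B &
    (fine (w B) < inf V + n.+1%:R^-1)%R].
  have : (0 < n.+1%:R^-1 :> R)%R by rewrite invr_gt0.
  by move=> /(inf_adherent)/(_ V1)[_ [B [mB SB] <-] ?]; exists B.
pose E := \bigcap_n B n.
have mE : measurable E by apply: bigcap_measurable => // n _; case: (BP n).
have SE : S `<=` E by move=> x Sx n _; case: (BP n) => _ + _; exact.
exists E; split => // A mA SA.
have EA : (inf V <= fine (w (E `&` A)))%R.
  apply: ge_inf; first by case: V1.
  by exists (E `&` A) => //; split; [exact: measurableI|move=> x Sx; split; [exact: SE|exact: SA]].
have EV : (fine (w E) <= inf V)%R.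
  apply/ler_addgt0Pr => e e0.
  have [n ne] : exists n, (n.+1%:R^-1 < e)%R.
    by have [n _ ne] := near_infty_natSinv_lt (PosNum e0); exists n; exact: (ne n (leqnn _)).
  have [mB SB Bn] := BP n.
  rewrite (@le_trans _ _ (fine (w (B n))))//.
    by rewrite fine_le ?fin_num_measure// le_measure ?inE// => x; exact.
  by rewrite ltW// (lt_trans Bn)// ltrD2l.
apply/eqP; rewrite eq_le measure_ge0 andbT.
have -> : w (E `\` A) = w E - w (E `&` A).
  by rewrite measureD// -ge0_fin_numE// fin_num_measure.
rewrite (wfin E)// (wfin (E `&` A)); last exact: measurableI.
by rewrite -EFinB lee_fin subr_le0 (le_trans EV).
Qed.

(** Hulls chosen separately need not be nested. Intersecting all hulls of index at least [n] makes
    them so, and the result still contains [S n] because [S] increases. *)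
Lemma measurable_hull_seq (S : (set T)^nat) : nondecreasing_seq S ->
  exists F : (set T)^nat, [/\ nondecreasing_seq F,
    forall n, measurable (F n) /\ S n `<=` F n &
    forall n B, measurable B -> S n `<=` B -> w (F n `\` B) = 0].
Proof.
move=> ndS; have /choice[E EP] := fun n => measurable_hull (S n).
exists (fun n => \bigcap_(k in [set k | (n <= k)%N]) E k); split.
- move=> m n mn; apply/subsetPset => x Ex k /= nk.
  by apply: Ex => /=; exact: leq_trans nk.
- move=> n; split.
    by apply: bigcap_measurable => [|k _]; [exists n => /=|case: (EP k)].
  move=> x Snx k /= nk; case: (EP k) => _ + _; apply.
  by move/subsetPset : (ndS _ _ nk); apply.
- move=> n B mB SB; have [mE SE EB] := EP n.
  apply: (@subset_measure0 _ _ _ w _ (E n `\` B)); last exact: EB.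
  - apply: measurableD => //.
    by apply: bigcap_measurable => [|k _]; [exists n => /=|case: (EP k)].
  - exact: measurableD.
  - by move=> x [Ex Bx]; split => //; apply: Ex => /=.
Qed.

End measurable_hull.

(** * Square integrals and simple approximation in L^2 *)

Section square_integrals.
Context d (T : measurableType d) (R : realType).
Implicit Types a b g : T -> R.

Lemma measurable_sqr_EFin g : measurable_fun setT g ->
  measurable_fun setT (fun x => (g x ^+ 2)%:E).
Proof. by move=> mg; apply/measurable_EFinP; exact: measurable_funX. Qed.

Lemma ge0_le_integral_lin (m : {measure set T -> \bar R}) (a b : R)
    (f g1 g2 : T -> \bar R) : (0 <= a)%R -> (0 <= b)%R ->
  measurable_fun setT f -> measurable_fun setT g1 -> measurable_fun setT g2 ->
  (forall z, 0 <= f z) -> (forall z, 0 <= g1 z) -> (forall z, 0 <= g2 z) ->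
  (forall z, f z <= a%:E * g1 z + b%:E * g2 z) ->
  \int[m]_z f z <= a%:E * \int[m]_z g1 z + b%:E * \int[m]_z g2 z.
Proof.
move=> a0 b0 mf mg1 mg2 f0 g10 g20 fg.
rewrite -!ge0_integralZl ?lee_fin// -ge0_integralD//; last 4 first.
- by move=> z _; rewrite mule_ge0 ?lee_fin.
- exact: emeasurable_funM.
- by move=> z _; rewrite mule_ge0 ?lee_fin.
- exact: emeasurable_funM.
apply: ge0_le_integral => //.
by apply: emeasurable_funD; exact: emeasurable_funM.
Qed.

Lemma le_integral_sqrD (m : {measure set T -> \bar R}) f a b :
  measurable_fun setT f -> measurable_fun setT a -> measurable_fun setT b ->
  (forall x, f x = a x + b x)%R ->
  \int[m]_x (f x ^+ 2)%:E <=
  2%:E * \int[m]_x (a x ^+ 2)%:E + 2%:E * \int[m]_x (b x ^+ 2)%:E.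
Proof.
move=> mf ma mb fab.
have m2 (g : T -> R) := @measurable_sqr_EFin g.
have g2 (g : T -> R) x : 0 <= (g x ^+ 2)%:E by rewrite lee_fin sqr_ge0.
apply: ge0_le_integral_lin => //; try exact: m2.
move=> x; rewrite -!EFinM -EFinD lee_fin fab.
have := sqr_ge0 (a x - b x); rewrite !expr2; lra.
Qed.

Import HBSimple HBNNSimple.

(** The approximants are [1_(F n) (p n - q n)], with [p n] and [q n] increasing to the positive and
    negative parts of [g]; the squared error never exceeds [g ^ 2], so dominated convergence
    applies. Support in a single [F n] later confines the decay estimates to the hull of a set where
    [M] is bounded. *)
Lemma sfun_dense_L2 (w : {measure set T -> \bar R}) (F : (set T)^nat) g (e : R) :
  (forall n, measurable (F n)) -> nondecreasing_seq F ->
  {ae w, forall x, exists n, F n x} ->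
  measurable_fun setT g -> \int[w]_x (g x ^+ 2)%:E < +oo -> (0 < e)%R ->
  exists n (f : {sfun T >-> R}), (forall x, ~ F n x -> f x = 0%R) /\
    \int[w]_x ((g x - f x) ^+ 2)%:E <= e%:E.
Proof.
move=> mF ndF FT mg g2 e0.
pose gp x : R := Num.max (g x) 0%R; pose gn x : R := Num.max (- g x)%R 0%R.
have mgp : measurable_fun setT (EFin \o gp).
  by apply/measurable_EFinP; exact: measurable_maxr.
have mgn : measurable_fun setT (EFin \o gn).
  by apply/measurable_EFinP; apply: measurable_maxr => //; exact: measurable_funN.
have gp0 x : (0 <= gp x)%R by rewrite /gp le_max lexx orbT.
have gn0 x : (0 <= gn x)%R by rewrite /gn le_max lexx orbT.
have gE x : g x = (gp x - gn x)%R.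
  by rewrite /gp /gn; case: (leP (g x) 0%R); case: (leP (- g x)%R 0%R); lra.
pose p n := nnsfun_approx measurableT mgp n.
pose q n := nnsfun_approx measurableT mgn n.
have pg n x : (0 <= p n x <= gp x)%R.
  rewrite fun_ge0 -lee_fin /p nnsfun_approxE.
  by apply: (le_approx _ (f := EFin \o gp)) => //= y _; rewrite lee_fin.
have qg n x : (0 <= q n x <= gn x)%R.
  rewrite fun_ge0 -lee_fin /q nnsfun_approxE.
  by apply: (le_approx _ (f := EFin \o gn)) => //= y _; rewrite lee_fin.
pose f n : {sfun T >-> R} := (mindic R (mF n) \* (p n \+ cst (-1) \* q n))%R.
have fE n x : f n x = (\1_(F n) x * (p n x - q n x))%R by rewrite /= mulN1r.
have gf n x : ((g x - f n x) ^+ 2 <= g x ^+ 2)%R.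
  rewrite fE indicE; have /andP[] := pg n x; have /andP[] := qg n x.
  case: (_ \in _); last by rewrite mul0r subr0.
  rewrite mul1r /gp /gn; set u := p n x; set v := q n x.
  by case: (leP (g x) 0%R); case: (leP (- g x)%R 0%R); nra.
have gfcvg : {ae w, forall x, setT x ->
    (fun n => ((g x - f n x) ^+ 2)%:E) @ \oo --> (cst 0 x : \bar R)}.
  apply: filterS FT => x [N FNx] _ /=.
  have pc : (fun n => (p n x)%:E) @ \oo --> (gp x)%:E.
    by apply: (cvg_nnsfun_approx _ mgp) => // y _; rewrite lee_fin.
  have qc : (fun n => (q n x)%:E) @ \oo --> (gn x)%:E.
    by apply: (cvg_nnsfun_approx _ mgn) => // y _; rewrite lee_fin.
  have {}pc : (fun n => p n x) @ \oo --> gp x by exact: fine_cvg pc.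
  have {}qc : (fun n => q n x) @ \oo --> gn x by exact: fine_cvg qc.
  apply: cvg_EFin; first exact: nearW.
  have gpq : (fun n => g x - (p n x - q n x))%R @ \oo --> (g x - (gp x - gn x))%R.
    by apply: cvgB; [exact: cvg_cst|exact: cvgB].
  have gpq0 : ((fun n => g x - (p n x - q n x)) * (fun n => g x - (p n x - q n x)))%R @ \oo
      --> (0 : R)%R.
    by have -> : (0 = (g x - (gp x - gn x)) * (g x - (gp x - gn x)))%R;
      [rewrite -gE subrr mulr0|exact: cvgM].
  apply: cvg_trans gpq0; apply: near_eq_cvg.
  exists N => // n Nn; rewrite [RHS](_ : _ = (g x - f n x) ^+ 2)%R// fE indicE.
  rewrite mem_set ?mul1r ?expr2//.
  by move/subsetPset : (ndF _ _ Nn); apply.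
have int_g : w.-integrable setT (fun x => (g x ^+ 2)%:E).
  apply/integrableP; split; first exact: measurable_sqr_EFin.
  by under eq_integral do rewrite gee0_abs ?lee_fin ?sqr_ge0//.
have gfdom : {ae w, forall x n, setT x -> `|((g x - f n x) ^+ 2)%:E| <= (g x ^+ 2)%:E}.
  by apply: aeW => x n _; rewrite gee0_abs lee_fin ?sqr_ge0.
have mgf n : measurable_fun setT (fun x => ((g x - f n x) ^+ 2)%:E).
  by apply: measurable_sqr_EFin; exact: measurable_funB.
have [_ _] := dominated_convergence measurableT mgf (measurable_cst _) gfcvg int_g gfdom.
rewrite integral_cst// mul0e => /fine_cvgP[gffin gf0].
have : \forall n \near \oo, \int[w]_x ((g x - f n x) ^+ 2)%:E <= e%:E.
  near=> n; rewrite -[leLHS]fineK; last by near: n; exact: gffin.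
  rewrite lee_fin (le_trans (ler_norm _))//; near: n.
  by move/cvgr0_norm_le : gf0; apply.
move=> [n _ /(_ n (leqnn n)) gfe]; exists n, (f n); split => // x Fx.
by rewrite fE indicE memNset// mul0r.
Unshelve. all: by end_near. Qed.

End square_integrals.

(* A sequence of squared norms of iterates of a symmetric operator is
   log-convex, so its first ratio is bounded by its asymptotic rate. *)
Lemma logconvex_ratio_le (R : realType) (a : nat -> R) (C t : R) :
  (forall n, 0 <= a n)%R -> (0 < t)%R ->
  (forall n, a n.+1 ^+ 2 <= a n * a n.+2)%R ->
  (forall n, a n <= C * t ^+ n)%R -> (a 1%N <= t * a 0%N)%R.
Proof.
move=> a0 t0 aa aC; have [a00|a00] := eqVneq (a 0%N) 0%R.
  have := aa 0%N; rewrite a00 mul0r mulr0 => a1.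
  by rewrite -(@ler_pXn2r _ 2)// ?nnegrE// expr0n.
have {}a00 : (0 < a 0%N)%R by rewrite lt0r a00 a0.
rewrite -ler_pdivrMr//; set r := (a 1%N / a 0%N)%R.
have r0 : (0 <= r)%R by rewrite divr_ge0.
(* Log-convexity makes the successive ratios nondecreasing, so the first one, [r], bounds them all
   from below. *)
have ra n : (r * a n <= a n.+1)%R.
  elim: n => [|n ih]; first by rewrite /r divfK// gt_eqF.
  have [an0|an0] := eqVneq (a n) 0%R.
    have := aa n; rewrite an0 mul0r => a1.
    suff -> : a n.+1 = 0%R by rewrite mulr0.
    by apply/eqP; rewrite -sqrf_eq0 eq_le a1 sqr_ge0.
  have {}an0 : (0 < a n)%R by rewrite lt0r an0 a0.
  rewrite -(ler_pM2l an0) (le_trans _ (aa n))// mulrA [(a n * r)%R]mulrC.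
  by rewrite expr2 ler_wpM2r.
have {}ra n : (a 0%N * r ^+ n <= C * t ^+ n)%R.
  apply: le_trans (aC n); elim: n => [|n ih]; first by rewrite mulr1.
  by rewrite (le_trans _ (ra n))// exprS mulrCA ler_wpM2l.
rewrite leNgt; apply/negP => tr.
have {}r0 : (0 < r)%R by apply: lt_trans tr.
(* If [t < r], then [a 0 <= C (t / r) ^ n] for all [n], and the right-hand side tends to 0. *)
have : (a 0%N <= 0)%R.
  have sC : geometric C (t / r)%R @ \oo --> (0 : R)%R.
    by apply: cvg_geometric; rewrite ger0_norm ?ltr_pdivrMr ?mul1r// divr_ge0// ltW.
  rewrite -(cvg_lim _ sC)//; apply: limr_ge; first by apply/cvg_ex; exists 0%R.
  by apply: nearW => n /=; rewrite expr_div_n mulrA ler_pdivlMr ?exprn_gt0//.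
by rewrite leNgt a00.
Qed.

(** * Bounded measurable functions and their integrals *)

Section bounded_measurable.
Context d (T : measurableType d) (R : realType).
Implicit Types f g : T -> R.

(* Locked, so that [done] does not unfold the conjunction. *)
Fact bounded_measurable_key : unit. Proof. exact: tt. Qed.
Definition bounded_measurable := locked_with bounded_measurable_key
  (fun f => measurable_fun setT f /\ exists c, forall x, (`|f x| <= c)%R).
Local Notation bm := bounded_measurable.

Lemma bmP f :
  bm f <-> measurable_fun setT f /\ exists c, forall x, (`|f x| <= c)%R.
Proof. by rewrite /bounded_measurable unlock. Qed.

Lemma bm_measurable f : bm f -> measurable_fun setT f.
Proof. by case/bmP. Qed.

Lemma bm_cst (c : R) : bm (fun=> c).
Proof. by apply/bmP; split=> //; exists `|c|%R. Qed.

Lemma bm_indic A : measurable A -> bm (\1_A).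
Proof.
move=> mA; apply/bmP; split=> //; exists 1%R => x; rewrite indicE.
by case: (_ \in _); rewrite ?normr1 ?normr0.
Qed.

Lemma bmD f g : bm f -> bm g -> bm (fun x => f x + g x)%R.
Proof.
move=> /bmP[mf [c fc]] /bmP[mg [c' gc]]; apply/bmP; split; first exact: measurable_funD.
by exists (c + c')%R => x; rewrite (le_trans (ler_normD _ _))// lerD.
Qed.

Lemma bmM f g : bm f -> bm g -> bm (fun x => f x * g x)%R.
Proof.
move=> /bmP[mf [c fc]] /bmP[mg [c' gc]]; apply/bmP; split; first exact: measurable_funM.
by exists (c * c')%R => x; rewrite normrM ler_pM.
Qed.

Lemma bmZ k f : bm f -> bm (fun x => k * f x)%R.
Proof. by move=> bf; apply: bmM => //; exact: bm_cst. Qed.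

Lemma bmB f g : bm f -> bm g -> bm (fun x => f x - g x)%R.
Proof.
move=> bf bg; have := bmD bf (bmZ (-1) bg).
by under eq_fun do rewrite mulN1r.
Qed.

Lemma bm_sqr f : bm f -> bm (fun x => f x ^+ 2)%R.
Proof. by move=> bf; have := bmM bf bf; under eq_fun do rewrite -expr2. Qed.

Lemma bm_integrable (m : {measure set T -> \bar R}) f :
  m setT <= 1 -> bm f -> m.-integrable setT (EFin \o f).
Proof.
move=> m1 /bmP[mf [c fc]]; apply/integrableP; split; first exact/measurable_EFinP.
apply: (@le_lt_trans _ _ (\int[m]_x (cst c%:E) x)).
  apply: ge0_le_integral => //.
  - by apply/measurableT_comp => //; exact/measurable_EFinP.
  - by move=> x _ /=; rewrite lee_fin.
rewrite integral_cst//.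
have c0 : (0 <= c)%R by rewrite (le_trans _ (fc point)).
rewrite (@le_lt_trans _ _ (c%:E * 1))// ?lee_wpmul2l ?lee_fin//.
by rewrite mule1 ltry.
Qed.

Lemma bm_norm_integral_le (m : {measure set T -> \bar R}) f (c : R) :
  m setT <= 1 -> measurable_fun setT f -> (forall x, `|f x| <= c)%R ->
  (`|\int[m]_x f x| <= c)%R.
Proof.
move=> m1 mf fc; have c0 : (0 <= c)%R by rewrite (le_trans _ (fc point)).
have int_f : m.-integrable setT (EFin \o f).
  by apply: bm_integrable => //; apply/bmP; split => //; exists c.
rewrite -lee_fin EFin_normr_Rintegral//.
apply: (le_trans (le_abse_integral _ _ _)) => //; first exact/measurable_EFinP.
apply: (@le_trans _ _ (\int[m]_x (cst c%:E) x)).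
  apply: ge0_le_integral => //.
  - by apply/measurableT_comp => //; exact/measurable_EFinP.
  - by move=> x _ /=; rewrite lee_fin.
by rewrite integral_cst// -[leRHS]mule1 lee_wpmul2l ?lee_fin.
Qed.

Section integral.
Variable m : {measure set T -> \bar R}.
Hypothesis m_le1 : m setT <= 1.

Lemma bm_EFin_integral f : bm f ->
  (\int[m]_x f x)%R%:E = \int[m]_x (f x)%:E.
Proof.
by move=> bf; rewrite fineK//; apply: integrable_fin_num => //; exact: bm_integrable.
Qed.

Lemma bm_integralD f g : bm f -> bm g ->
  (\int[m]_x (f x + g x) = \int[m]_x f x + \int[m]_x g x)%R.
Proof. by move=> bf bg; apply: RintegralD => //; exact: bm_integrable. Qed.

Lemma bm_integralB f g : bm f -> bm g ->
  (\int[m]_x (f x - g x) = \int[m]_x f x - \int[m]_x g x)%R.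
Proof. by move=> bf bg; apply: RintegralB => //; exact: bm_integrable. Qed.

Lemma bm_integralZ k f : bm f ->
  (\int[m]_x (k * f x) = k * \int[m]_x f x)%R.
Proof. by move=> bf; apply: RintegralZl => //; exact: bm_integrable. Qed.

Lemma bm_integral_le f g : bm f -> bm g -> (forall x, f x <= g x)%R ->
  (\int[m]_x f x <= \int[m]_x g x)%R.
Proof. by move=> bf bg fg; apply: le_Rintegral => //; exact: bm_integrable. Qed.

End integral.

End bounded_measurable.

Ltac solve_bm := repeat first [assumption | exact: bm_cst | exact: bm_sqr |
  apply: bmB | apply: bmD | apply: bmM].

(** * Jensen-type inequalities for measures of mass at most 1 *)

Section jensen.
Context d (T : measurableType d) (R : realType) (m : {measure set T -> \bar R}).
Hypothesis m_le1 : m setT <= 1.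

Lemma poweR2_EFin (r : R) : `|r%:E| `^ 2 = (r ^+ 2)%:E.
Proof. by rewrite abse_EFin poweR_EFin powR_mulrn// real_normK// num_real. Qed.

Lemma integrable_of_sqr (g : T -> R) : measurable_fun setT g ->
  \int[m]_x (g x ^+ 2)%:E < +oo -> m.-integrable setT (EFin \o g).
Proof.
move=> mg g2; have mg2 := measurable_sqr_EFin mg.
apply: (@le_integrable _ _ _ m setT measurableT _ (EFin \o (fun x => 1 + g x ^+ 2)%R)) => //.
- exact/measurable_EFinP.
- move=> x _ /=; rewrite lee_fin [leRHS]ger0_norm ?addr_ge0 ?sqr_ge0//.
  by have := sqr_ge0 (`|g x| - 1)%R; have := real_normK (num_real (g x)); nra.
- apply: (integrableD measurableT (f := fun=> 1) (g := fun x => (g x ^+ 2)%:E)) => //.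
    by apply: (bm_integrable m_le1 (bm_cst T (1 : R)%R)).
  apply/integrableP; split => //.
  by under eq_integral do rewrite gee0_abs ?lee_fin ?sqr_ge0//.
Qed.

(** Expand the integral of [(g - r) ^ 2 >= 0] at the mean [r]; the constant term contributes at most
    [r ^ 2] because the mass is at most 1. The left side is written in the extended reals, as in the
    integrand of the norm of [kernel_act]. *)
Lemma integral_sqr_ge (g : T -> R) : measurable_fun setT g ->
  `|\int[m]_x (g x)%:E| `^ 2 <= \int[m]_x (g x ^+ 2)%:E.
Proof.
move=> mg; have [g2|] := ltP (\int[m]_x (g x ^+ 2)%:E) +oo; last first.
  by rewrite leye_eq => /eqP ->; rewrite leey.
have ig := integrable_of_sqr mg g2.
have ig2 : m.-integrable setT (fun x => (g x ^+ 2)%:E).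
  apply/integrableP; split; first exact: measurable_sqr_EFin.
  by under eq_integral do rewrite gee0_abs ?lee_fin ?sqr_ge0//.
have gE : \int[m]_x (g x)%:E = (\int[m]_x g x)%R%:E.
  by rewrite fineK// integrable_fin_num.
have g2E : \int[m]_x (g x ^+ 2)%:E = (\int[m]_x (g x ^+ 2))%R%:E.
  by rewrite fineK// (@integrable_fin_num _ _ _ m setT).
rewrite gE g2E poweR2_EFin lee_fin; set r := (\int[m]_x g x)%R.
have icst : m.-integrable setT (EFin \o (fun=> r ^+ 2)%R).
  exact: bm_integrable m_le1 (bm_cst _ _).
have irg : m.-integrable setT (EFin \o (fun x => - (2 * r) * g x)%R).
  exact: (integrableZl measurableT (- (2 * r))%R ig).
have : (0 <= \int[m]_x ((g x ^+ 2 + - (2 * r) * g x) + r ^+ 2))%R.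
  apply: Rintegral_ge0 => x _; have := sqr_ge0 (g x - r)%R; rewrite !expr2; lra.
have isum : m.-integrable setT (EFin \o (fun x => g x ^+ 2 + - (2 * r) * g x)%R).
  exact: (integrableD measurableT ig2 irg).
rewrite (RintegralD measurableT isum icst) (RintegralD measurableT _ irg)//.
rewrite (RintegralZl _ measurableT ig) -/r (Rintegral_cst m measurableT).
have : (fine (m setT) <= 1)%R.
  by rewrite -lee_fin fineK// ge0_fin_numE// (le_lt_trans m_le1)// ltry.
have := sqr_ge0 r; nra.
Qed.

(* [(1 + e) s^2 + (1 + 1/e) (x - s)^2 >= x^2] applied to [s] the mean of [g] *)
Lemma sqr_le_integral (g : T -> R) (x e : R) : m setT = 1 -> (0 < e)%R ->
  measurable_fun setT g ->
  (x ^+ 2)%:E <= (1 + e)%:E * `|\int[m]_u (g u)%:E| `^ 2 +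
    (1 + e^-1)%:E * \int[m]_u ((x - g u) ^+ 2)%:E.
Proof.
move=> m1 e0 mg; have mxg : measurable_fun setT (fun u => x - g u)%R.
  exact: measurable_funB.
have e1 : (0 < 1 + e^-1)%R by rewrite addr_gt0// invr_gt0.
have s0 : 0 <= (1 + e)%:E * `|\int[m]_u (g u)%:E| `^ 2.
  by rewrite mule_ge0// ?poweR_ge0// lee_fin addr_ge0// ltW.
have [xg2|] := ltP (\int[m]_u ((x - g u) ^+ 2)%:E) +oo; last first.
  rewrite leye_eq => /eqP ->; rewrite gt0_muley ?lte_fin// addey ?leey//.
  by rewrite gt_eqF// (lt_le_trans _ s0)// ltNyr.
have ixg := integrable_of_sqr mxg xg2.
have ix : m.-integrable setT (EFin \o fun=> x).
  exact: bm_integrable m_le1 (bm_cst _ _).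
have ig : m.-integrable setT (EFin \o g).
  apply: eq_integrable (integrableB measurableT ix ixg) => // u _ /=.
  by rewrite -EFinB; congr EFin; ring.
have gE : \int[m]_u (g u)%:E = (\int[m]_u g u)%R%:E.
  by rewrite fineK// integrable_fin_num.
have := integral_sqr_ge mxg.
have -> : \int[m]_u (x - g u)%:E = (x - \int[m]_u g u)%:E.
  have := RintegralB measurableT ix ig.
  rewrite Rintegral_cst// m1 mulr1 => <-.
  by rewrite fineK// integrable_fin_num.
rewrite gE !poweR2_EFin; set s := (\int[m]_u g u)%R.
move=> xsg; apply: (@le_trans _ _ ((1 + e)%:E * (s ^+ 2)%:E + (1 + e^-1)%:E * ((x - s) ^+ 2)%:E)).
  rewrite -!EFinM -EFinD lee_fin.
  have -> : ((1 + e) * s ^+ 2 + (1 + e^-1) * (x - s) ^+ 2 =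
     x ^+ 2 + e^-1 * (e * s - (x - s)) ^+ 2)%R by field; rewrite gt_eqF.
  by rewrite lerDl mulr_ge0 ?invr_ge0 ?sqr_ge0// ltW.
by apply: leeD => //; rewrite lee_wpmul2l// lee_fin ltW.
Qed.

End jensen.

(** * Reversible kernels: spectral gap, Poincare inequality and operator norm *)

Section reversible_kernel.
Context d (T : measurableType d) (R : realType).
Variables (w : probability T R) (K : T -> {measure set T -> \bar R}).

(** Real-valued counterpart of [kernel_act], used on bounded functions, where mass at most 1 keeps
    every integral finite. *)
Definition kernel_op (f : T -> R) (z : T) : R := (\int[K z]_u f u)%R.

(** Twice the customary Dirichlet form [<f, f - P f>], in a shape that is meaningful for unbounded
    [f] as well. *)
Definition dirichlet (f : T -> R) : \bar R :=
  \int[w]_z \int[K z]_u ((f z - f u) ^+ 2)%:E.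

(** These conditions are what cut-off Gibbs kernels satisfy: outside the state space they may lose
    mass, so mass 1 is available only almost everywhere, while the bound by 1 holds at every point
    and keeps [kernel_op] a contraction for the uniform norm. [K_rev] is detailed balance, stated
    for functions of the pair of successive states. *)
Hypothesis K_le1 : forall z, K z setT <= 1.
Hypothesis K_meas : forall F : T * T -> \bar R, (forall p, 0 <= F p) ->
  measurable_fun setT F -> measurable_fun setT (fun z => \int[K z]_u F (z, u)).
Hypothesis K_rev : forall F : T * T -> \bar R, (forall p, 0 <= F p) ->
  measurable_fun setT F ->
  \int[w]_z \int[K z]_u F (z, u) = \int[w]_z \int[K z]_u F (u, z).
Hypothesis K_markov : {ae w, forall z, K z setT = 1}.

Local Notation bm := (@bounded_measurable _ T R).
Local Notation op := kernel_op.

(** Detailed balance moves [g] from the new state to the old one, where it is constant for the inner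
    integral, and almost every [K z] has mass 1. *)
Lemma ge0_integral_invariant (g : T -> \bar R) :
  (forall z, 0 <= g z) -> measurable_fun setT g ->
  \int[w]_z \int[K z]_u g u = \int[w]_z g z.
Proof.
move=> g0 mg; rewrite -(K_rev (F := g \o fst)) => [|p|]; last 2 first.
- exact: g0.
- exact: (measurable_fun_fst (f := g)).
apply: ge0_ae_eq_integral => //.
- by apply: (K_meas (F := g \o fst)) => [p|]; [exact: g0|exact: (measurable_fun_fst (f := g))].
- by move=> z _; apply: integral_ge0 => u _; exact: g0.
- case: K_markov => N [mN N0 KN]; exists N; split => // z /= h; apply: KN => /= Kz.
  by apply: h => _; rewrite integral_cst// Kz mule1.
Qed.

Let w_le1 : w setT <= 1. Proof. by rewrite probability_setT. Qed.

Lemma bm_op f : bm f -> bm (op f).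
Proof.
move=> bf; have /bmP[mf [c fc]] := bf.
have c0 : (0 <= c)%R by rewrite (le_trans _ (fc point)).
have bfc : bm (fun x => f x + c)%R by apply: bmD => //; exact: bm_cst.
have nn g : bm g -> (forall x, 0 <= g x)%R -> measurable_fun setT (op g).
  move=> bg g0; apply: (measurableT_comp (f := fine)) => //.
  apply: (K_meas (F := fun p => (g p.2)%:E)) => [p|]; rewrite ?lee_fin//.
  by apply/measurable_EFinP; apply: measurableT_comp => //; exact: bm_measurable.
apply/bmP; split.
- have -> : op f = (fun z => op (fun x => f x + c) z - op (fun=> c) z)%R.
    apply/funext => z; rewrite -[RHS]bm_integralB//; last exact: bm_cst.
    by apply: eq_Rintegral => x _; rewrite addrK.
  apply: measurable_funB; apply: nn => //; last exact: bm_cst.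
  by move=> x; rewrite -lerBlDr sub0r lerNl (le_trans _ (fc x))// -normrN ler_norm.
- exists c => z; have int_f := bm_integrable (K_le1 z) bf.
  exact: bm_norm_integral_le.
Qed.

(* The general case follows from the nonnegative one by adding constants. *)
Lemma op_sym f g : bm f -> bm g ->
  (\int[w]_z (f z * op g z) = \int[w]_z (g z * op f z))%R.
Proof.
have nn f' g' : bm f' -> bm g' -> (forall x, 0 <= f' x)%R -> (forall x, 0 <= g' x)%R ->
  (\int[w]_z (f' z * op g' z) = \int[w]_z (g' z * op f' z))%R.
  move=> bf bg f0 g0.
  have mf := bm_measurable bf; have mg := bm_measurable bg.
  apply: EFin_inj.
  rewrite (bm_EFin_integral w_le1 (bmM bf (bm_op bg))).
  rewrite (bm_EFin_integral w_le1 (bmM bg (bm_op bf))).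
  transitivity (\int[w]_z \int[K z]_u (f' z * g' u)%:E).
    apply: eq_integral => z _; rewrite EFinM bm_EFin_integral//.
    by rewrite -ge0_integralZl ?lee_fin//; [exact/measurable_EFinP|move=> u _; rewrite lee_fin].
  rewrite (K_rev (F := fun p => (f' p.1 * g' p.2)%:E))/=.
  - apply: eq_integral => z _; rewrite EFinM bm_EFin_integral//.
    rewrite -ge0_integralZl ?lee_fin//; [|exact/measurable_EFinP|by move=> u _; rewrite lee_fin].
    by apply: eq_integral => u _; rewrite EFinM muleC.
  - by move=> p; rewrite lee_fin mulr_ge0.
  - apply/measurable_EFinP; apply: measurable_funM.
      exact: measurable_fun_fst.
    exact: measurable_fun_snd.
pose S f g := (\int[w]_z (f z * op g z) = \int[w]_z (g z * op f z))%R.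
have subS f' g1 g2 : bm f' -> bm g1 -> bm g2 -> S f' g1 -> S f' g2 ->
    S f' (fun x => g1 x - g2 x)%R.
  move=> bf b1 b2 S1 S2; rewrite /S.
  transitivity (\int[w]_z (f' z * op g1 z - f' z * op g2 z))%R.
    apply: eq_Rintegral => z _.
    by rewrite -mulrBr /kernel_op (bm_integralB (K_le1 z) b1 b2).
  rewrite (bm_integralB w_le1 (bmM bf (bm_op b1)) (bmM bf (bm_op b2))).
  rewrite S1 S2.
  rewrite -(bm_integralB w_le1 (bmM b1 (bm_op bf)) (bmM b2 (bm_op bf))).
  by apply: eq_Rintegral => z _; rewrite mulrBl.
have shift (f' : T -> R) : bm f' -> exists2 c : R, (0 <= c)%R & forall x, (0 <= f' x + c)%R.
  move=> /bmP[_ [c fc]]; exists c => [|x]; first by rewrite (le_trans _ (fc point)).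
  by rewrite -lerBlDr sub0r lerNl (le_trans _ (fc x))// -normrN ler_norm.
have addK (f' : T -> R) (a : R) : f' = (fun x => f' x + a - a)%R.
  by apply/funext => x; rewrite addrK.
have S1 f' g' : bm f' -> bm g' -> (forall x, 0 <= f' x)%R -> S f' g'.
  move=> bf' bg' f0; have [b b0 gb] := shift _ bg'; rewrite (addK g' b).
  have bb : bm (fun=> b) := bm_cst _ b.
  have bgb := bmD bg' bb.
  exact: subS bf' bgb bb (nn _ _ bf' bgb f0 gb) (nn _ _ bf' bb f0 (fun=> b0)).
move=> bf bg; have [a a0 fa] := shift _ bf; have ba : bm (fun=> a) := bm_cst _ a.
have bfa := bmD bf ba; apply/esym; rewrite -/(S g f) (addK f a).
apply: (subS _ _ _ bg bfa ba); apply/esym; [exact: S1 bfa bg fa|].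
exact: S1 ba bg (fun=> a0).
Qed.

Lemma op1_ae : {ae w, forall z, op (fun=> 1%R) z = 1%R}.
Proof.
apply: filterS K_markov => z Kz1.
by rewrite /kernel_op Rintegral_cst// Kz1 mul1r.
Qed.

Lemma E_op f : bm f -> (\int[w]_z op f z = \int[w]_z f z)%R.
Proof.
move=> bf; have b1 := bm_cst T (1 : R)%R; have bop := bm_op bf.
transitivity (\int[w]_z (f z * op (fun=> 1%R) z))%R.
  by rewrite op_sym//; apply: eq_Rintegral => z _; rewrite mul1r.
have bop1 := bm_op b1; have bm1 := bmM bf bop1.
congr fine; apply: ae_eq_integral => //.
- exact/measurable_EFinP/bm_measurable.
- exact/measurable_EFinP/bm_measurable.
- by apply: filterS op1_ae => z /= -> _; rewrite mulr1.
Qed.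

Lemma E_cst (k : R) : (\int[w]_z k = k)%R.
Proof.
rewrite (Rintegral_cst w measurableT) -[RHS]mulr1; congr (_ * _)%R.
by rewrite [X in fine X](@probability_setT _ _ _ w).
Qed.

Lemma E_quad (a b : R) f g : bm f -> bm g ->
  (\int[w]_z ((a * f z + b * g z) ^+ 2) =
   a ^+ 2 * \int[w]_z (f z ^+ 2) + 2 * a * b * \int[w]_z (f z * g z) +
   b ^+ 2 * \int[w]_z (g z ^+ 2))%R.
Proof.
move=> bf bg.
have bf2 := bm_sqr bf; have bg2 := bm_sqr bg; have bfg := bmM bf bg.
rewrite -!bm_integralZ// -!bm_integralD//; try solve_bm.
by apply: eq_Rintegral => z _; ring.
Qed.

Lemma E_sqr_ge0 f : (0 <= \int[w]_z (f z ^+ 2))%R.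
Proof. by apply: Rintegral_ge0 => z _; exact: sqr_ge0. Qed.

(** The quadratic form [q] is nonnegative. It is evaluated at [(A, - C)] or [(- C, B)] when [A] or
    [B] is nonzero, and at [(1, 1)] and [(1, -1)] when both vanish. *)
Lemma E_cauchy_schwarz f g : bm f -> bm g ->
  ((\int[w]_z (f z * g z)) ^+ 2 <=
   \int[w]_z (f z ^+ 2) * \int[w]_z (g z ^+ 2))%R.
Proof.
move=> bf bg.
have q a b : (0 <= a ^+ 2 * \int[w]_z (f z ^+ 2) +
    2 * a * b * \int[w]_z (f z * g z) + b ^+ 2 * \int[w]_z (g z ^+ 2))%R.
  by rewrite -E_quad//; exact: (E_sqr_ge0 (fun z => a * f z + b * g z)%R).
move: q; have := E_sqr_ge0 f; have := E_sqr_ge0 g.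
set A := (\int[w]_z (g z ^+ 2))%R; set B := (\int[w]_z (f z ^+ 2))%R.
set C := (\int[w]_z (f z * g z))%R.
move=> A0 B0 q.
have [A00|A00] := eqVneq A 0%R; last first.
  have A1 : (0 < A)%R by rewrite lt0r A00 A0.
  by have := q A (- C)%R; nra.
have [B00|B00] := eqVneq B 0%R; last first.
  have B1 : (0 < B)%R by rewrite lt0r B00 B0.
  by have := q (- C)%R B; nra.
by have := q 1%R 1%R; have := q 1%R (-1)%R; nra.
Qed.

Lemma bm_iter_op n f : bm f -> bm (iter n op f).
Proof. by move=> bf; elim: n => [//|n ih]; exact: bm_op. Qed.

Lemma E_iter_op n f : bm f -> (\int[w]_z iter n op f z = \int[w]_z f z)%R.
Proof.
by move=> bf; elim: n => [//|n ih]; rewrite /= E_op//; exact: bm_iter_op.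
Qed.

Lemma E_iter_sym n m f g : bm f -> bm g ->
  (\int[w]_z (iter n op f z * iter m op g z) =
   \int[w]_z (f z * iter (n + m) op g z))%R.
Proof.
move=> bf bg; elim: n m => [//|n ih] m; rewrite addSnnS -ih/=.
under eq_Rintegral do rewrite mulrC.
by rewrite op_sym//; exact: bm_iter_op.
Qed.

(** By symmetry [|P^n f|^2 = <f, P^(2n) f>], which the hypothesis controls. Log-convexity is the
    Cauchy-Schwarz inequality for [<P^n f, P^(n+2) f> = |P^(n+1) f|^2]. *)
Lemma contraction_of_decay f (C t : R) : bm f -> (0 < t)%R ->
  (forall n, \int[w]_z (f z * iter (n + n) op f z) <= C * t ^+ n)%R ->
  (\int[w]_z (op f z ^+ 2) <= t * \int[w]_z (f z ^+ 2))%R.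
Proof.
move=> bf t0 fC.
have sqE n : (\int[w]_z (iter n op f z ^+ 2) =
    \int[w]_z (f z * iter (n + n) op f z))%R.
  by rewrite -E_iter_sym//; apply: eq_Rintegral => z _; rewrite expr2.
apply: (@logconvex_ratio_le _ (fun n => \int[w]_z (iter n op f z ^+ 2))%R C _ _ t0).
- by move=> n; exact: E_sqr_ge0.
- move=> n; rewrite sqE addSnnS -E_iter_sym//.
  by apply: E_cauchy_schwarz; exact: bm_iter_op.
- by move=> n; rewrite sqE.
Qed.

(** After expanding the square, the term [f ^ 2 * op 1] is not pointwise [f ^ 2], as [K z] has mass
    1 only almost everywhere. Symmetry of [op] turns its integral into that of [op (f ^ 2)], and
    invariance into that of [f ^ 2]. *)
Lemma dirichletE f : bm f -> dirichlet f =
  (2 * \int[w]_z (f z ^+ 2) - 2 * \int[w]_z (f z * op f z))%R%:E.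
Proof.
move=> bf; have bf2 := bm_sqr bf; have b1 := bm_cst T (1 : R)%R.
have bof := bm_op bf; have bof2 := bm_op bf2; have bo1 := bm_op b1.
have bA : bm (fun z => f z ^+ 2 * op (fun=> 1%R) z)%R := bmM bf2 bo1.
have bB : bm (fun z => 2 * (f z * op f z))%R := bmZ _ (bmM bf bof).
pose G z := (f z ^+ 2 * op (fun=> 1) z - 2 * (f z * op f z) + op (fun x => f x ^+ 2) z)%R.
have bG : bm G by apply: bmD => //; exact: bmB.
transitivity (\int[w]_z (G z)%:E).
  apply: eq_integral => z _; rewrite -bm_EFin_integral//; last first.
    by apply: bm_sqr; apply: bmB => //; exact: bm_cst.
  congr EFin; rewrite /G /kernel_op mulrA.
  have bfz := bm_cst T (f z).
  rewrite -!bm_integralZ// -bm_integralB// -?bm_integralD//; try solve_bm.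
  by apply: eq_Rintegral => u _; ring.
rewrite -bm_EFin_integral//; congr EFin.
rewrite bm_integralD//; last exact: bmB.
rewrite bm_integralB// E_op// bm_integralZ//; last exact: bmM.
suff -> : (\int[w]_z (f z ^+ 2 * op (fun=> 1) z) = \int[w]_z (f z ^+ 2))%R by ring.
  by rewrite (op_sym bf2 b1) -(E_op bf2); apply: eq_Rintegral => z _; rewrite mul1r.
Qed.

(** Expanding [|t f - P f|^2 >= 0] and using [|P f| <= t |f|] gives [<f, P f> <= t |f|^2]. *)
Lemma dirichlet_gap f (t : R) : bm f -> (0 < t)%R ->
  (\int[w]_z (op f z ^+ 2) <= t ^+ 2 * \int[w]_z (f z ^+ 2))%R ->
  (2 * (1 - t) * \int[w]_z (f z ^+ 2))%:E <= dirichlet f.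
Proof.
move=> bf t0 opf; rewrite dirichletE// lee_fin.
have : (0 <= \int[w]_z ((t * f z + (-1) * op f z) ^+ 2))%R.
  exact: (E_sqr_ge0 (fun z => t * f z + (-1) * op f z)%R).
rewrite E_quad//; last exact: bm_op.
move: opf; set A := (\int[w]_z (op f z ^+ 2))%R.
set B := (\int[w]_z (f z ^+ 2))%R; set C := (\int[w]_z (f z * op f z))%R.
move=> AB q; have {}q : (2 * t * C <= 2 * t * (t * B))%R by nra.
have : (C <= t * B)%R by rewrite -(ler_pM2l (_ : 0 < 2 * t)%R)// mulr_gt0.
by move=> CB; nra.
Qed.

Lemma iter_opD n f g z : bm f -> bm g ->
  iter n op (fun x => f x + g x)%R z = (iter n op f z + iter n op g z)%R.
Proof.
move=> bf bg; elim: n z => [//|n ih] z /=.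
rewrite -[RHS]bm_integralD//; [|exact: bm_iter_op..].
by apply: eq_Rintegral => u _; exact: ih.
Qed.

Lemma iter_opZ n k f z : bm f ->
  iter n op (fun x => k * f x)%R z = (k * iter n op f z)%R.
Proof.
move=> bf; elim: n z => [//|n ih] z /=.
rewrite -[RHS]bm_integralZ//; last exact: bm_iter_op.
by apply: eq_Rintegral => u _; exact: ih.
Qed.

Lemma iter_op_indic n A z : measurable A ->
  (iter n op \1_A z)%:E = kernel_iter K n z A.
Proof.
move=> mA; elim: n z => [|n ih] z /=; first by rewrite diracE indicE.
rewrite bm_EFin_integral//; last exact/bm_iter_op/bm_indic.
by apply: eq_integral => u _; exact: ih.
Qed.

(** * From pointwise geometric decay to a spectral gap *)

Section decay.
Variables (Z : set T) (M : T -> R) (t : R).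
Hypotheses (t01 : (0 < t < 1)%R).
Hypothesis Kgeo : forall z, Z z -> forall n,
  tv_dist (kernel_iter K n z) w <= (M z * t ^+ n)%:E.

(** The constant [C] belongs to [f] alone while the starting point enters through [M z]. The
    property is thus linear in [f], and on a sublevel set of [M] it becomes a uniform rate. *)
Definition decays f := exists2 C, (0 <= C)%R & forall z, Z z -> forall n,
  (`|iter n op f z - \int[w]_x f x| <= C * (M z * t ^+ n))%R.

Lemma decays_indic A : measurable A -> decays \1_A.
Proof.
move=> mA; exists 1%R => // z Zz n; rewrite mul1r -lee_fin.
apply: le_trans (Kgeo Zz n); apply: ereal_sup_ubound => /=; exists A => //.
rewrite -iter_op_indic// -abse_EFin EFinB; congr (`| _ - _ |).
by rewrite bm_EFin_integral//; [rewrite integral_indic// setIT|exact: bm_indic].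
Qed.

Lemma decaysD f g : bm f -> bm g -> decays f -> decays g ->
  decays (fun x => f x + g x)%R.
Proof.
move=> bf bg [C C0 fC] [D D0 gD]; exists (C + D)%R; first exact: addr_ge0.
move=> z Zz n; rewrite iter_opD// bm_integralD//.
rewrite opprD addrACA (le_trans (ler_normD _ _))// mulrDl.
by rewrite lerD ?fC ?gD.
Qed.

Lemma decaysZ k f : bm f -> decays f -> decays (fun x => k * f x)%R.
Proof.
move=> bf [C C0 fC]; exists (`|k| * C)%R; first by rewrite mulr_ge0.
move=> z Zz n; rewrite iter_opZ// bm_integralZ//.
by rewrite -mulrBr normrM -mulrA ler_wpM2l ?fC.
Qed.

Lemma decays_cst c : decays (fun=> c).
Proof.
have := decaysZ c (bm_indic R measurableT) (decays_indic measurableT).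
by congr decays; apply/funext => x; rewrite indicT mulr1.
Qed.

Import HBSimple.

Lemma bm_sfun (f : {sfun T >-> R}) : bm f.
Proof.
apply/bmP; split => //; have [c [_ fc]] := simple_bounded f.
by exists (c + 1)%R => x; apply: fc => //; rewrite ltrDl.
Qed.

Lemma decays_sfun (f : {sfun T >-> R}) : decays f.
Proof.
have -> : (f : T -> R) = (fun x => \sum_(y <- finmap.enum_fset (fset_set (range f)))
    y * \1_(f @^-1` [set y]) x)%R.
  by apply/funext => x; rewrite [LHS]fimfunE fsbig_finite.
have b1 y : bm \1_(f @^-1` [set y]) by exact: bm_indic.
suff : forall s : seq R, bm (fun x => \sum_(y <- s) y * \1_(f @^-1` [set y]) x)%R /\
   decays (fun x => \sum_(y <- s) y * \1_(f @^-1` [set y]) x)%R.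
  by move=> fs; exact: (fs _).2.
elim=> [|y s [ih1 ih2]].
  under eq_fun do rewrite big_nil.
  by split; [exact: bm_cst|exact: decays_cst].
under eq_fun do rewrite big_cons.
split; first by apply: bmD => //; exact: bmZ.
apply: decaysD => //; first exact: bmZ.
by apply: decaysZ => //; exact: decays_indic.
Qed.

(** [F] is a hull of the set where [M <= m]. Since [f] lives on [F], pairing [f] with the iterates
    of [f - c] only sees points where these are uniformly of order [t ^ n], up to a null set. *)
Lemma decays_gap (F : set T) (m : R) (f : {sfun T >-> R}) :
  measurable F -> (0 <= m)%R ->
  (forall B, measurable B -> [set z | Z z /\ (M z <= m)%R] `<=` B ->
    w (F `\` B) = 0) ->
  (forall z, ~ F z -> f z = 0%R) ->
  (2 * (1 - t) * \int[w]_z ((f z - \int[w]_x f x) ^+ 2))%R%:E <= dirichlet f.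
Proof.
move=> mF m0 hullF fF; have /andP[t0 t1] := t01.
have bf := bm_sfun f; set c := (\int[w]_x f x)%R; pose g z := (f z - c)%R.
have bc := bm_cst T c; have bg : bm g := bmB bf bc.
have Eg0 : (\int[w]_z g z = 0)%R.
  rewrite (bm_integralB w_le1 bf bc) E_cst -/c.
  exact: subrr.
have [C C0 gC] : decays g.
  exact: decaysD bf (bm_cst T (- c)%R) (decays_sfun f) (decays_cst (- c)%R).
have /bmP[_ [D fD]] := bf; have D0 : (0 <= D)%R by rewrite (le_trans _ (fD point)).
have -> : dirichlet f = dirichlet g.
  apply: eq_integral => z _; apply: eq_integral => u _.
  by congr (_ ^+ 2)%:E; rewrite /g; ring.
(* The contraction lemma is used at rate [t ^ 2], since [2 n] steps decay like [(t ^ 2) ^ n]. [D]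
   bounds [|f|], and [C m] is the decay constant where [M <= m]. *)
apply: dirichlet_gap => //; apply: (@contraction_of_decay _ (D * (C * m))) => //.
  exact: exprn_gt0.
move=> n; set u := iter (n + n) op g; have bu : bm u by exact: bm_iter_op.
(* [B] is measurable and contains the set where [M <= m], so by the hull property it contains [F] up
   to a null set. *)
pose B := [set z | (`|u z| <= C * (m * t ^+ (n + n)))%R].
have mu := bm_measurable bu; have tn0 : (0 <= t ^+ (n + n))%R by exact/exprn_ge0/ltW.
have mB : measurable B.
  rewrite -[B]setTI; apply: (measurable_fun_le (f := fun z => `|u z|%R)) => //.
  exact: measurableT_comp.
have SB : [set z | Z z /\ (M z <= m)%R] `<=` B.
  move=> z [Zz Mz]; have := gC _ Zz (n + n)%N; rewrite Eg0 subr0 => /le_trans; apply.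
  by rewrite ler_wpM2l// ler_wpM2r.
have bfu := bmM bf bu; have bcu := bmM bc bu.
have bfuB := bmM bfu (bm_indic R mB).
(* The constant [c] drops out because the iterate has mean zero, and inserting the indicator of [B]
   changes nothing because [f] vanishes off [F]. *)
have -> : (\int[w]_z (g z * u z) = \int[w]_z (f z * u z * \1_B z))%R.
  transitivity (\int[w]_z (f z * u z - c * u z))%R.
    by apply: eq_Rintegral => z _; rewrite mulrBl.
  rewrite (bm_integralB w_le1 bfu bcu) (bm_integralZ w_le1 c bu) (E_iter_op _ bg).
  rewrite Eg0 mulr0 subr0; congr fine; apply: ae_eq_integral => //.
  - exact/measurable_EFinP/bm_measurable.
  - exact/measurable_EFinP/bm_measurable.
  exists (F `\` B); split; [exact: measurableD|exact: hullF|move=> z /= fuB].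
  split; first by apply: contrapT => Fz; apply: fuB => _; rewrite fF// !mul0r.
  by move=> Bz; apply: fuB => _; rewrite indicE mem_set// mulr1.
have -> : (D * (C * m) * (t ^+ 2) ^+ n = \int[w]_z (D * (C * (m * t ^+ (n + n)))))%R.
  rewrite E_cst.
  by rewrite -exprM mul2n addnn !mulrA.
apply: (bm_integral_le w_le1 bfuB (bm_cst _ _)) => z.
have [Bz|Bz] := pselect (B z); rewrite indicE.
  by rewrite mem_set// mulr1 (le_trans (ler_norm _))// normrM ler_pM.
by rewrite memNset// mulr0 !mulr_ge0.
Qed.

End decay.

Implicit Types f g : T -> R.

Let mdiff g : measurable_fun setT g ->
  measurable_fun setT (fun p : T * T => ((g p.1 - g p.2) ^+ 2)%:E).
Proof.
move=> mg; apply/measurable_EFinP; apply: measurable_funX.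
by apply: measurable_funB; [exact: measurable_fun_fst|exact: measurable_fun_snd].
Qed.

Lemma measurable_dirichlet g : measurable_fun setT g ->
  measurable_fun setT (fun z => \int[K z]_u ((g z - g u) ^+ 2)%:E).
Proof.
move=> mg; apply: (K_meas (F := fun p => ((g p.1 - g p.2) ^+ 2)%:E)).
  by move=> p; rewrite lee_fin sqr_ge0.
exact: mdiff.
Qed.

Let integral_sqr_ge0 (m : {measure set T -> \bar R}) g :
  0 <= \int[m]_u (g u ^+ 2)%:E.
Proof. by apply: integral_ge0 => u _; rewrite lee_fin sqr_ge0. Qed.

Lemma measurable_integral_sqr g : measurable_fun setT g ->
  measurable_fun setT (fun z => \int[K z]_u (g u ^+ 2)%:E).
Proof.
move=> mg; apply: (K_meas (F := fun p => (g p.2 ^+ 2)%:E)).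
  by move=> p; rewrite lee_fin sqr_ge0.
apply: (measurable_fun_snd (f := fun u => (g u ^+ 2)%:E)).
exact: measurable_sqr_EFin.
Qed.

Lemma integral_sqr_invariant g : measurable_fun setT g ->
  \int[w]_z \int[K z]_u (g u ^+ 2)%:E = \int[w]_z (g z ^+ 2)%:E.
Proof.
move=> mg; rewrite (ge0_integral_invariant (g := fun u => (g u ^+ 2)%:E))//.
  by move=> z; rewrite lee_fin sqr_ge0.
exact: measurable_sqr_EFin.
Qed.

(** Continuity of the form in L^2, needed to pass from simple functions to arbitrary ones:
    [(a - b) ^ 2 <= 2 a ^ 2 + 2 b ^ 2], and by invariance both terms have the same integral. *)
Lemma dirichlet_le g : measurable_fun setT g ->
  dirichlet g <= 4%:E * \int[w]_z (g z ^+ 2)%:E.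
Proof.
move=> mg.
have -> : 4%:E * \int[w]_z (g z ^+ 2)%:E =
    2%:E * \int[w]_z (g z ^+ 2)%:E + 2%:E * \int[w]_z (\int[K z]_u (g u ^+ 2)%:E).
  rewrite integral_sqr_invariant// -ge0_muleDl ?lee_fin//.
  by congr (_ * _); rewrite -EFinD; congr EFin; ring.
apply: ge0_le_integral_lin => //.
- exact: measurable_dirichlet.
- exact: measurable_sqr_EFin.
- exact: measurable_integral_sqr.
- by move=> z; rewrite lee_fin sqr_ge0.
- move=> z; apply: (le_trans (le_integral_sqrD (K z) (a := fun=> g z)
    (b := fun u => - g u)%R _ _ _ _)) => //.
  + exact: measurable_funB.
  + exact: measurable_funN.
  under [X in _ + _ * X]eq_integral do rewrite sqrrN.
  apply: leeD => //; rewrite lee_wpmul2l ?lee_fin// integral_cst//.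
  by rewrite -[leRHS]mule1 lee_wpmul2l// lee_fin sqr_ge0.
Qed.

Lemma dirichletD_le f (a b : T -> R) : measurable_fun setT f -> measurable_fun setT a ->
  measurable_fun setT b -> (forall z, f z = a z + b z)%R ->
  dirichlet f <= 2%:E * dirichlet a + 2%:E * dirichlet b.
Proof.
move=> mf ma mb fab; apply: ge0_le_integral_lin => //.
- exact: measurable_dirichlet.
- exact: measurable_dirichlet.
- exact: measurable_dirichlet.
- move=> z; apply: le_integral_sqrD.
  + exact: measurable_funB.
  + exact: measurable_funB.
  + exact: measurable_funB.
  + by move=> u; rewrite !fab; ring.
Qed.

Import HBSimple.

(** The centre [c] is the mean of a simple approximation of [g], so it varies with the tolerance
    [e]. This weak form is enough, because a function of [L2_01] stays at distance at least 1 from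
    every constant. *)
Theorem geometric_poincare (Z : set T) : measurable Z -> w Z = 1 ->
  geometrically_ergodic Z w K -> exists2 C : R, (0 < C)%R &
  forall g, measurable_fun setT g -> \int[w]_z (g z ^+ 2)%:E < +oo ->
  forall e : R, (0 < e)%R -> exists c : R,
    \int[w]_z ((g z - c) ^+ 2)%:E <= C%:E * dirichlet g + e%:E.
Proof.
move=> mZ wZ [M [t [t01 Kgeo]]]; have /andP[t0 t1] := t01.
have t1' : (0 < 1 - t)%R by rewrite subr_gt0.
(* The gap constant [1 / (2 (1 - t))] is multiplied by 2 twice: once for replacing [g - c] by
   [f - c], once for replacing the form of [f] by that of [g]. *)
exists (2 / (1 - t))%R => [|g mg g2 e e0]; first by rewrite divr_gt0.
pose S (n : nat) := [set z | Z z /\ (M z <= n%:R)%R].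
have [|F [ndF mF hullF]] := measurable_hull_seq w (S := S).
  move=> m n mn; apply/subsetPset => z [Zz Mz]; split => //.
  by rewrite (le_trans Mz)// ler_nat.
(* [M] is real-valued, so its sublevel sets exhaust [Z], which has full mass. *)
have FT : {ae w, forall z, exists n, F n z}.
  exists (~` Z); split; [exact: measurableC|by rewrite probability_setC// wZ subee|].
  move=> z /= Fz Zz; apply: Fz.
  exists (Num.truncn `|M z|).+1; apply: (mF _).2; split => //.
  by rewrite (le_trans (ler_norm _))// ltW// truncnS_gt.
(* An approximation error [dl] enters as [2 dl] directly and as [8 dl / (1 - t)] through the
   Dirichlet form; the total is [e]. *)
pose dl := (e / (2 + 8 / (1 - t)))%R.
have K0 : (0 < 2 + 8 / (1 - t))%R by rewrite addr_gt0// divr_gt0.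
have dl0 : (0 < dl)%R by rewrite divr_gt0.
have [n [f [fF gf]]] := sfun_dense_L2 (fun n => (mF n).1) ndF FT mg g2 dl0.
pose c := (\int[w]_x f x)%R; exists c.
have bf := bm_sfun f; have mf := bm_measurable bf.
have mgf : measurable_fun setT (fun z => g z - f z)%R by exact: measurable_funB.
have mfc : measurable_fun setT (fun z => f z - c)%R by exact: measurable_funB.
have mfg : measurable_fun setT (fun z => f z - g z)%R by exact: measurable_funB.
have gap := decays_gap t01 Kgeo (mF n).1 (ler0n R n) (hullF n) fF.
have fc : \int[w]_z ((f z - c) ^+ 2)%:E <= ((2 * (1 - t))^-1)%:E * dirichlet f.
  have -> : \int[w]_z ((f z - c) ^+ 2)%:E =
      ((2 * (1 - t))^-1)%:E * (2 * (1 - t) * \int[w]_z ((f z - c) ^+ 2))%R%:E.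
    rewrite -EFinM mulrA mulVf ?mul1r ?gt_eqF ?mulr_gt0//.
    by rewrite (bm_EFin_integral w_le1 (bm_sqr (bmB bf (bm_cst T c)))).
  by rewrite lee_wpmul2l// lee_fin invr_ge0 mulr_ge0// ltW.
have df : dirichlet f <= 2%:E * dirichlet g + (8 * dl)%:E.
  have fE z : f z = (g z + (f z - g z))%R by ring.
  apply: (le_trans (dirichletD_le mf mg mfg fE)).
  apply: leeD => //; apply: (@le_trans _ _ (2%:E * (4%:E * dl%:E))).
    rewrite lee_wpmul2l ?lee_fin//; apply: (le_trans (dirichlet_le mfg)).
    rewrite lee_wpmul2l ?lee_fin// (le_trans _ gf)//.
    by under eq_integral do rewrite -sqrrN opprB.
  by rewrite -!EFinM lee_fin; lra.
have mgc : measurable_fun setT (fun z => g z - c)%R by exact: measurable_funB.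
have gcE z : (g z - c = g z - f z + (f z - c))%R by ring.
apply: (le_trans (le_integral_sqrD w mgc mgf mfc gcE)).
have D0 : 0 <= dirichlet g.
  by apply: integral_ge0 => z _; exact: (integral_sqr_ge0 _ (fun u => g z - g u)%R).
have k0 : 0 <= ((2 * (1 - t))^-1)%:E by rewrite lee_fin invr_ge0 mulr_ge0// ltW.
apply: (@le_trans _ _ (2%:E * dl%:E +
    2%:E * (((2 * (1 - t))^-1)%:E * (2%:E * dirichlet g + (8 * dl)%:E)))).
  apply: leeD; rewrite lee_wpmul2l ?lee_fin//.
  by rewrite (le_trans fc)// lee_wpmul2l.
case: (dirichlet g) D0 => [r r0| |//]; last first.
  by move=> _; rewrite [leRHS](_ : _ = +oo) ?leey// gt0_muley ?lte_fin ?divr_gt0// addye.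
rewrite -!EFinM -!EFinD lee_fin le_eqVlt; apply/orP; left; apply/eqP.
by rewrite /dl; field; rewrite !gt_eqF//= /K0; nra.
Qed.

Lemma L2_01P f : L2_01 w f -> measurable_fun setT f /\
  \int[w]_z (f z ^+ 2)%:E = 1.
Proof.
move=> [/sub_Lfun_mfun]; rewrite inE/= => mf _; rewrite unlock => f2.
by split.
Qed.

Lemma measurable_kernel_act f : measurable_fun setT f ->
  measurable_fun setT (kernel_act K f).
Proof.
move=> mf; pose fp := (EFin \o f)^\+; pose fn := (EFin \o f)^\-.
have mfp : measurable_fun setT fp by exact/measurable_funepos/measurable_EFinP.
have mfn : measurable_fun setT fn by exact/measurable_funeneg/measurable_EFinP.
rewrite (_ : kernel_act K f = (fun z => \int[K z]_u fp u - \int[K z]_u fn u)).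
  apply: emeasurable_funB.
    apply: (K_meas (F := fun p => fp p.2)) => [p|]; first exact: funepos_ge0.
    exact: measurable_fun_snd.
  apply: (K_meas (F := fun p => fn p.2)) => [p|]; first exact: funeneg_ge0.
  exact: measurable_fun_snd.
by apply/funext => z; rewrite /kernel_act integralE.
Qed.

Let measurable_act2 f : measurable_fun setT f ->
  measurable_fun setT (fun z => `|kernel_act K f z| `^ 2).
Proof.
move=> mf; apply: (measurableT_comp (measurable_poweR _)) => //.
by apply: measurableT_comp => //; exact: measurable_kernel_act.
Qed.

Lemma integral_act_sqr_le f : measurable_fun setT f ->
  \int[w]_z (`|kernel_act K f z| `^ 2) <= \int[w]_z (f z ^+ 2)%:E.
Proof.
move=> mf; rewrite -integral_sqr_invariant//; apply: ge0_le_integral => //.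
- by move=> z _; exact: poweR_ge0.
- exact: measurable_act2.
- exact: measurable_integral_sqr.
- by move=> z _; exact: integral_sqr_ge.
Qed.

(** Integrates [sqr_le_integral], valid wherever [K z] has mass 1. It plays the part of the triangle
    inequality for [f = P f + (f - P f)]: a small [e] keeps the factor of [|P f|^2] near 1 at the
    price of a large weight on the Dirichlet form. *)
Lemma sqr_le_act_dirichlet f (e : R) : (0 < e)%R -> measurable_fun setT f ->
  \int[w]_z (f z ^+ 2)%:E <=
  (1 + e)%:E * \int[w]_z (`|kernel_act K f z| `^ 2) + (1 + e^-1)%:E * dirichlet f.
Proof.
move=> e0 mf.
have e1 : 0 <= (1 + e)%:E by rewrite lee_fin addr_ge0// ltW.
have e2 : 0 <= (1 + e^-1)%:E by rewrite lee_fin addr_ge0// invr_ge0 ltW.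
have mA := measurable_act2 mf; have mD := measurable_dirichlet mf.
have A0 z : setT z -> 0 <= `|kernel_act K f z| `^ 2 by move=> _; exact: poweR_ge0.
have D0 z : setT z -> 0 <= \int[K z]_u ((f z - f u) ^+ 2)%:E.
  by move=> _; exact: (integral_sqr_ge0 _ (fun u => f z - f u)%R).
have mA' : measurable_fun setT (fun z => (1 + e)%:E * (`|kernel_act K f z| `^ 2)).
  exact: emeasurable_funM.
have mD' : measurable_fun setT
    (fun z => (1 + e^-1)%:E * \int[K z]_u ((f z - f u) ^+ 2)%:E).
  exact: emeasurable_funM.
have A0' z : setT z -> 0 <= (1 + e)%:E * (`|kernel_act K f z| `^ 2).
  by move=> zT; rewrite mule_ge0// A0.
have D0' z : setT z -> 0 <= (1 + e^-1)%:E * \int[K z]_u ((f z - f u) ^+ 2)%:E.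
  by move=> zT; rewrite mule_ge0// D0.
rewrite -(ge0_integralZl w measurableT mA A0 e1) -(ge0_integralZl w measurableT mD D0 e2).
rewrite -(ge0_integralD w measurableT A0' mA' D0' mD').
apply: ae_ge0_le_integral => //.
- by move=> z _; rewrite lee_fin sqr_ge0.
- exact: measurable_sqr_EFin.
- by move=> z zT; rewrite adde_ge0// ?A0' ?D0'.
- exact: emeasurable_funD.
- by apply: filterS K_markov => z Kz1 _; exact: sqr_le_integral.
Qed.

(** The upper bound is Jensen's inequality followed by invariance. For the lower bound, a norm below
    1 would contradict the previous inequality at a unit vector with small Dirichlet form. *)
Theorem kernel_norm_eq1 :
  (forall e : R, (0 < e)%R -> exists2 f, L2_01 w f & dirichlet f <= e%:E) ->
  kernel_norm w K = 1.
Proof.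
move=> small; set N := kernel_norm w K.
have Nub f : L2_01 w f -> 'N[w]_2%:E[kernel_act K f] <= N.
  by move=> f01; apply: ereal_sup_ubound; exists f.
apply/eqP; rewrite eq_le; apply/andP; split.
  apply: ge_ereal_sup => _ [f /L2_01P[mf f2] <-].
  rewrite unlock -[leRHS](@poweR1r R 2^-1) gt0_ler_poweR ?invr_ge0//.
  - by rewrite in_itv/= leey andbT; apply: integral_ge0 => z _; exact: poweR_ge0.
  - by rewrite in_itv/= leey lee01.
  - by rewrite -f2; exact: integral_act_sqr_le.
have N0 : 0 <= N.
  by have [f f01 _] := small _ ltr01; exact: le_trans (Lnorm_ge0 _ _ _) (Nub f f01).
rewrite leNgt; apply/negP => N1.
have Nfin : N \is a fin_num by rewrite ge0_fin_numE// (lt_trans N1)// ltry.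
pose x := (1 - fine N)%R.
have x0 : (0 < x)%R by rewrite subr_gt0 -lte_fin fineK.
have x1 : (x <= 1)%R by rewrite lerBlDr lerDl fine_ge0.
(* With weight [e = x] and form at most [x ^ 3 / 4], the right-hand side is at most
   [(1 + x) ((1 - x) ^ 2 + x ^ 2 / 4)], which is below 1 for [0 < x <= 1]. *)
have dl0 : (0 < x ^+ 3 / 4)%R by rewrite divr_gt0// exprn_gt0.
have [f f01 fdl] := small _ dl0; have [mf f2] := L2_01P f01.
have := sqr_le_act_dirichlet x0 mf; rewrite f2; apply/negP; rewrite -ltNge.
have IN : \int[w]_z (`|kernel_act K f z| `^ 2) <= ((1 - x) ^+ 2)%:E.
  have -> : ((1 - x) ^+ 2)%:E = N `^ 2.
    rewrite -(fineK Nfin) poweR_EFin powR_mulrn ?fine_ge0//.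
    by congr EFin; rewrite /x; ring.
  rewrite -poweR_Lnorm// gt0_ler_poweR ?Nub//.
    by rewrite in_itv/= leey Lnorm_ge0.
  by rewrite in_itv/= leey N0.
apply: (@le_lt_trans _ _ ((1 + x)%:E * ((1 - x) ^+ 2)%:E + (1 + x^-1)%:E * (x ^+ 3 / 4)%:E)).
  by apply: leeD; apply: lee_wpmul2l => //; rewrite lee_fin addr_ge0 ?invr_ge0// ltW.
rewrite -!EFinM -EFinD lte_fin.
have -> : ((1 + x^-1) * (x ^+ 3 / 4) = (x + 1) * x ^+ 2 / 4)%R.
  by field; rewrite gt_eqF.
by rewrite !expr2; nra.
Qed.

(** Since [f] has mean 0 and second moment 1, the integral equals [1 + c ^ 2]. *)
Lemma L2_01_integral_center f c : L2_01 w f ->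
  1 <= \int[w]_z ((f z - c) ^+ 2)%:E.
Proof.
move=> f01; have [mf f2] := L2_01P f01.
have f1 : \int[w]_z (f z)%:E = 0 by case: f01 => _; rewrite unlock.
have if2 : w.-integrable setT (EFin \o (fun z => f z ^+ 2)%R).
  apply/integrableP; split; first exact: measurable_sqr_EFin.
  under eq_integral do rewrite /= ger0_norm ?sqr_ge0//.
  by rewrite f2 ltry.
have i_f : w.-integrable setT (EFin \o f).
  by apply: (integrable_of_sqr w_le1 mf); rewrite f2 ltry.
have icf : w.-integrable setT (EFin \o (fun z => - (2 * c) * f z)%R).
  exact: (integrableZl measurableT (- (2 * c))%R i_f).
have icc : w.-integrable setT (EFin \o (fun=> c ^+ 2)%R).
  exact: bm_integrable w_le1 (bm_cst _ _).
have i12 : w.-integrable setT (EFin \o (fun z => f z ^+ 2 + - (2 * c) * f z)%R).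
  exact: (integrableD measurableT if2 icf).
have -> : \int[w]_z ((f z - c) ^+ 2)%:E =
    \int[w]_z (f z ^+ 2 + - (2 * c) * f z + c ^+ 2)%:E.
  by apply: eq_integral => z _; congr EFin; ring.
rewrite (integralD_EFin measurableT i12 icc) (integralD_EFin measurableT if2 icf) f2.
have -> : \int[w]_z (- (2 * c) * f z)%:E = 0.
  by rewrite (integralZl measurableT i_f) f1 mule0.
rewrite integral_cst// [X in _ * X](@probability_setT _ _ _ w) mule1 adde0 leeDl//.
by rewrite lee_fin sqr_ge0.
Qed.

Theorem subgeometric_of_dirichlet (Z : set T) : measurable Z -> w Z = 1 ->
  (forall e : R, (0 < e)%R -> exists2 f, L2_01 w f & dirichlet f <= e%:E) ->
  subgeometrically_ergodic Z w K.
Proof.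
move=> mZ wZ small /(geometric_poincare mZ wZ)[C C0 poincare].
(* With tolerance 1/2, the Poincare inequality yields the contradiction [1 <= 1/4 + 1/2]. *)
have e0 : (0 < (4 * C)^-1)%R by rewrite invr_gt0 mulr_gt0.
have [f f01 fe] := small _ e0; have [mf f2] := L2_01P f01.
have f2y : \int[w]_z (f z ^+ 2)%:E < +oo by rewrite f2 ltry.
have h0 : (0 < 2^-1 :> R)%R by rewrite invr_gt0.
have [c fc] := poincare _ mf f2y _ h0.
have := le_trans (L2_01_integral_center c f01) fc.
apply/negP; rewrite -ltNge.
apply: (@le_lt_trans _ _ (C%:E * ((4 * C)^-1)%:E + (2^-1)%:E)).
  by rewrite leeD2r// lee_wpmul2l// lee_fin ltW.
rewrite -EFinM -EFinD lte_fin invfM mulrCA divff ?gt_eqF// mulr1; lra.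
Qed.

End reversible_kernel.

(** * Gibbs kernels *)

Lemma measurable_fst_fst d1 d2 d3 (T1 : measurableType d1) (T2 : measurableType d2)
  (T3 : measurableType d3) :
  measurable_fun setT (fun p : T1 * T2 * T3 => p.1.1).
Proof. exact: measurableT_comp. Qed.

Lemma measurable_fst_snd d1 d2 d3 (T1 : measurableType d1) (T2 : measurableType d2)
  (T3 : measurableType d3) :
  measurable_fun setT (fun p : T1 * T2 * T3 => p.1.2).
Proof. exact: measurableT_comp. Qed.

Lemma measurable_snd_fst d1 d2 d3 (T1 : measurableType d1) (T2 : measurableType d2)
  (T3 : measurableType d3) :
  measurable_fun setT (fun p : T1 * (T2 * T3) => p.2.1).
Proof. exact: measurableT_comp. Qed.

Ltac meas_base := first
  [ assumption | exact: measurable_cst | exact: measurable_fst_fst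
  | exact: measurable_fst_snd | exact: measurable_snd_fst
  | exact: measurable_fst | exact: measurable_snd | exact: measurable_id ].

Ltac meas := repeat first
  [ meas_base
  | match goal with
    | |- measurable_fun _ (fun x => EFin _) => apply/measurable_EFinP
    | |- measurable_fun _ (fun x => (_ , _)) => apply: measurable_fun_pair
    | |- measurable_fun _ (fun x => mule _ _) => apply: emeasurable_funM
    | |- measurable_fun _ (fun x => adde _ _) => apply: emeasurable_funD
    | |- measurable_fun _ (fun x => GRing.mul _ _) => apply: measurable_funM
    | |- measurable_fun _ (fun x => GRing.exp _ _) => apply: measurable_funX
    | |- measurable_fun _ (fun x => (_ + - _)%R) => apply: measurable_funB
    | |- measurable_fun _ (fun x => (_ + _)%R) => apply: measurable_funD
    | |- measurable_fun _ (fun x => ?f _) => apply: (measurableT_comp (f := f))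
    end ].

Section tonelli.
Context d1 d2 (T1 : measurableType d1) (T2 : measurableType d2) (R : realType).
Variables (m1 : {sigma_finite_measure set T1 -> \bar R})
          (m2 : {sigma_finite_measure set T2 -> \bar R}).

Lemma tonelli_swap (f : T1 -> T2 -> \bar R) : (forall x y, 0 <= f x y) ->
  measurable_fun setT (fun p : T1 * T2 => f p.1 p.2) ->
  \int[m1]_x \int[m2]_y f x y = \int[m2]_y \int[m1]_x f x y.
Proof.
by move=> f0 mf; rewrite (fubini_tonelli (fun p : T1 * T2 => f p.1 p.2)).
Qed.

Lemma measurable_integral_snd (f : T1 -> T2 -> \bar R) : (forall x y, 0 <= f x y) ->
  measurable_fun setT (fun p : T1 * T2 => f p.1 p.2) ->
  measurable_fun setT (fun x => \int[m2]_y f x y).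
Proof.
move=> f0 mf.
exact: (measurable_fun_fubini_tonelli_F (fun p : T1 * T2 => f p.1 p.2)).
Qed.

End tonelli.

(* c1 (x, y) and c2 (x, y) stand for the densities of x given y and of y given
   x, and q for the joint density, all cut off outside X and Y; alpha and beta
   are the marginal densities. *)
Record conditional_densities d1 d2 (T1 : measurableType d1) (T2 : measurableType d2)
    (R : realType) (X : set T1) (Y : set T2)
    (mu1 : {sigma_finite_measure set T1 -> \bar R})
    (mu2 : {sigma_finite_measure set T2 -> \bar R})
    (c1 c2 q : T1 * T2 -> R) (alpha : T1 -> R) (beta : T2 -> R) : Prop :=
  ConditionalDensities {
    cd_mX : measurable X ; cd_mY : measurable Y ;
    cd_mc1 : measurable_fun setT c1 ; cd_mc2 : measurable_fun setT c2 ;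
    cd_mq : measurable_fun setT q ;
    cd_malpha : measurable_fun setT alpha ; cd_mbeta : measurable_fun setT beta ;
    cd_c1_ge0 : forall p, (0 <= c1 p)%R ; cd_c2_ge0 : forall p, (0 <= c2 p)%R ;
    cd_alpha_ge0 : forall x, (0 <= alpha x)%R ; cd_beta_ge0 : forall y, (0 <= beta y)%R ;
    cd_c2_alpha : forall x y, (c2 (x, y) * alpha x = q (x, y))%R ;
    cd_c1_beta : forall x y, (c1 (x, y) * beta y = q (x, y))%R ;
    cd_c1_le1 : forall y, \int[mu1]_x (c1 (x, y))%:E <= 1 ;
    cd_c2_le1 : forall x, \int[mu2]_y (c2 (x, y))%:E <= 1 ;
    cd_c1_eq1 : forall y, Y y -> \int[mu1]_x (c1 (x, y))%:E = 1 ;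
    cd_c2_eq1 : forall x, X x -> \int[mu2]_y (c2 (x, y))%:E = 1 ;
    cd_c1_out : forall x y, ~ X x -> c1 (x, y) = 0%R ;
    cd_c2_out : forall x y, ~ Y y -> c2 (x, y) = 0%R ;
    cd_alpha_out : forall x, ~ X x -> alpha x = 0%R ;
    cd_beta_out : forall y, ~ Y y -> beta y = 0%R }.

(** The symmetry of the record lets everything proved for the X-chain apply to the Y-chain. *)
Lemma conditional_densities_swap d1 d2 (T1 : measurableType d1)
    (T2 : measurableType d2) (R : realType) (X : set T1) (Y : set T2)
    (mu1 : {sigma_finite_measure set T1 -> \bar R})
    (mu2 : {sigma_finite_measure set T2 -> \bar R})
    (c1 c2 q : T1 * T2 -> R) (alpha : T1 -> R) (beta : T2 -> R) :
  conditional_densities X Y mu1 mu2 c1 c2 q alpha beta ->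
  conditional_densities Y X mu2 mu1 (fun p => c2 (p.2, p.1)) (fun p => c1 (p.2, p.1))
    (fun p => q (p.2, p.1)) beta alpha.
Proof.
by case=> *; split => //= *; try meas; auto.
Qed.

(** * The marginal chain: reversibility and Dirichlet form *)

Section gibbs_kernels.
Context d1 d2 (T1 : measurableType d1) (T2 : measurableType d2) (R : realType).
Variables (X : set T1) (Y : set T2).
Variables (mu1 : {sigma_finite_measure set T1 -> \bar R})
          (mu2 : {sigma_finite_measure set T2 -> \bar R}).
Variables (c1 c2 q : T1 * T2 -> R) (alpha : T1 -> R) (beta : T2 -> R).
Hypothesis cd : conditional_densities X Y mu1 mu2 c1 c2 q alpha beta.

Let mc1 := cd_mc1 cd.
Let mc2 := cd_mc2 cd.
Let mq := cd_mq cd.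
Let malpha := cd_malpha cd.
Let mbeta := cd_mbeta cd.
Let c1_ge0 := cd_c1_ge0 cd.
Let c2_ge0 := cd_c2_ge0 cd.
Let alpha_ge0 := cd_alpha_ge0 cd.
Let beta_ge0 := cd_beta_ge0 cd.

(** Transition density from [x] to [x']; the arguments come in the opposite order to those of
    [kX]. *)
Definition rhoX (x x' : T1) : \bar R := \int[mu2]_y (c1 (x', y) * c2 (x, y))%:E.

Lemma rhoX_ge0 x x' : 0 <= rhoX x x'.
Proof. by apply: integral_ge0 => y _; rewrite lee_fin mulr_ge0. Qed.

Lemma measurable_rhoX2 : measurable_fun setT (fun p : T1 * T1 => rhoX p.1 p.2).
Proof.
apply: (@measurable_integral_snd _ _ _ _ _ mu2
  (fun (p : T1 * T1) y => (c1 (p.2, y) * c2 (p.1, y))%:E)) => [p y|].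
  by rewrite lee_fin mulr_ge0.
by meas.
Qed.

Lemma measurable_rhoX x : measurable_fun setT (rhoX x).
Proof. exact: (measurable_fun_pairl x measurable_rhoX2). Qed.

Definition KX x : {measure set T1 -> \bar R} :=
  mdens mu1 (rhoX_ge0 x) (measurable_rhoX x).

Lemma integral_KX x (f : T1 -> \bar R) : (forall u, 0 <= f u) ->
  measurable_fun setT f -> \int[KX x]_u f u = \int[mu1]_u (f u * rhoX x u).
Proof.
by move=> f0 mf; apply: ge0_integral_density => //; [exact: rhoX_ge0|exact: measurable_rhoX].
Qed.

Lemma integral_KX_tonelli x (f : T1 -> \bar R) : (forall u, 0 <= f u) ->
  measurable_fun setT f ->
  \int[KX x]_u f u =
  \int[mu2]_y \int[mu1]_u (f u * (c1 (u, y) * c2 (x, y))%:E).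
Proof.
move=> f0 mf; rewrite integral_KX//.
transitivity (\int[mu1]_u \int[mu2]_y (f u * (c1 (u, y) * c2 (x, y))%:E)).
  apply: eq_integral => u _; rewrite ge0_integralZl//; first by meas.
  by move=> y _; rewrite lee_fin mulr_ge0.
apply: (@tonelli_swap _ _ _ _ _ mu1 mu2 (fun u y => f u * (c1 (u, y) * c2 (x, y))%:E)).
  by move=> u y; rewrite mule_ge0// lee_fin mulr_ge0.
by meas.
Qed.

Lemma KX_setT x : KX x setT = \int[mu2]_y ((c2 (x, y))%:E * \int[mu1]_u (c1 (u, y))%:E).
Proof.
rewrite -[LHS]mul1e -[LHS]integral_cst// integral_KX_tonelli//.
apply: eq_integral => y _; rewrite -ge0_integralZl//; last 3 first.
- by meas.
- by move=> u _; rewrite lee_fin.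
- by rewrite lee_fin.
by apply: eq_integral => u _; rewrite mul1e -EFinM mulrC.
Qed.

Lemma KX_le1 x : KX x setT <= 1.
Proof.
rewrite KX_setT (le_trans _ (cd_c2_le1 cd x))//; apply: ge0_le_integral => //.
- move=> y _; rewrite mule_ge0 ?lee_fin//.
  by apply: integral_ge0 => u _; rewrite lee_fin.
- apply: emeasurable_funM; first by meas.
  apply: (@measurable_integral_snd _ _ _ _ _ mu1 (fun y u => (c1 (u, y))%:E)).
    by move=> y u; rewrite lee_fin.
  by meas.
- by meas.
- move=> y _; rewrite -[leRHS]mule1 lee_wpmul2l ?lee_fin//.
  exact: cd_c1_le1 cd y.
Qed.

Lemma KX_markov x : X x -> KX x setT = 1.
Proof.
move=> Xx; rewrite KX_setT -(cd_c2_eq1 cd Xx); apply: eq_integral => y _.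
have [Yy|Yy] := pselect (Y y); first by rewrite (cd_c1_eq1 cd Yy) mule1.
by rewrite (cd_c2_out cd _ Yy) mul0e.
Qed.

Lemma measurable_KX (F : T1 * T1 -> \bar R) : (forall p, 0 <= F p) ->
  measurable_fun setT F -> measurable_fun setT (fun x => \int[KX x]_u F (x, u)).
Proof.
move=> F0 mF.
rewrite (_ : (fun x => _) = (fun x => \int[mu1]_u (F (x, u) * rhoX x u))); last first.
  by apply/funext => x; rewrite (@integral_KX x (fun u => F (x, u)))//; meas.
apply: (@measurable_integral_snd _ _ _ _ _ mu1 (fun x u => F (x, u) * rhoX x u)).
  by move=> x u; rewrite mule_ge0// rhoX_ge0.
by apply: emeasurable_funM; [meas|exact: measurable_rhoX2].
Qed.

Section reversible.
Variable w1 : probability T1 R.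
Hypothesis w1E : forall A, measurable A -> w1 A = \int[mu1]_(x in A) (alpha x)%:E.
Hypothesis w1X : w1 X = 1.

Lemma integral_w1 (f : T1 -> \bar R) : (forall x, 0 <= f x) -> measurable_fun setT f ->
  \int[w1]_x f x = \int[mu1]_x (f x * (alpha x)%:E).
Proof.
by move=> f0 mf; apply: ge0_integral_density => //; meas.
Qed.

Lemma KX_markov_ae : {ae w1, forall x, KX x setT = 1}.
Proof.
exists (~` X); split; first exact/measurableC/(cd_mX cd).
  by rewrite probability_setC ?w1X ?subee//; exact: cd_mX cd.
by move=> x /= KXx Xx; apply: KXx; exact: KX_markov.
Qed.

(** [alpha] and [c2] merge into the joint density [q]. With [y] moved outermost, the law of two
    successive states appears as a mixture over [y] of laws on a fibre. *)
Lemma integral_w1_KX (F : T1 * T1 -> \bar R) : (forall p, 0 <= F p) ->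
  measurable_fun setT F ->
  \int[w1]_x \int[KX x]_u F (x, u) =
  \int[mu2]_y \int[mu1]_x \int[mu1]_u (F (x, u) * (c1 (u, y) * q (x, y))%:E).
Proof.
move=> F0 mF; rewrite integral_w1; last 2 first.
- by move=> x; exact: integral_ge0.
- exact: measurable_KX.
transitivity (\int[mu1]_x \int[mu2]_y \int[mu1]_u (F (x, u) * (c1 (u, y) * q (x, y))%:E)).
  apply: eq_integral => x _.
  rewrite (@integral_KX_tonelli x (fun u => F (x, u)))//; last by meas.
  have m3 : measurable_fun setT
      (fun p : T2 * T1 => F (x, p.2) * (c1 (p.2, p.1) * c2 (x, p.1))%:E) by meas.
  have p3 y u : 0 <= F (x, u) * (c1 (u, y) * c2 (x, y))%:E.
    by rewrite mule_ge0// lee_fin mulr_ge0.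
  rewrite -ge0_integralZr//; last 3 first.
  - exact: (@measurable_integral_snd _ _ _ _ _ mu1
      (fun y u => F (x, u) * (c1 (u, y) * c2 (x, y))%:E)).
  - by move=> y _; exact: integral_ge0.
  - by rewrite lee_fin.
  apply: eq_integral => y _; rewrite -ge0_integralZr//; last 2 first.
  - by meas.
  - by rewrite lee_fin.
  by apply: eq_integral => u _; rewrite -muleA -EFinM -mulrA (cd_c2_alpha cd).
apply: (@tonelli_swap _ _ _ _ _ mu1 mu2 (fun x y =>
  \int[mu1]_u (F (x, u) * (c1 (u, y) * q (x, y))%:E))).
  move=> x y; apply: integral_ge0 => u _; rewrite mule_ge0// lee_fin mulr_ge0//.
  by rewrite -(cd_c1_beta cd) mulr_ge0.
apply: (@measurable_integral_snd _ _ _ _ _ mu1 (fun (p : T1 * T2) u =>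
  F (p.1, u) * (c1 (u, p.2) * q (p.1, p.2))%:E)).
  move=> p u; rewrite mule_ge0// lee_fin mulr_ge0//.
  by rewrite -(cd_c1_beta cd) mulr_ge0.
by meas.
Qed.

Let q_ge0 p : (0 <= q p)%R.
Proof. by case: p => x y; rewrite -(cd_c1_beta cd) mulr_ge0. Qed.

(** The weight equals [c1 (u, y) * c1 (x, y) * beta y], symmetric in [x] and [u]: given [y], the two
    states are independent and identically distributed. *)
Lemma integral_swap_fiber y (F : T1 * T1 -> \bar R) : (forall p, 0 <= F p) ->
  measurable_fun setT F ->
  \int[mu1]_x \int[mu1]_u (F (x, u) * (c1 (u, y) * q (x, y))%:E) =
  \int[mu1]_x \int[mu1]_u (F (u, x) * (c1 (u, y) * q (x, y))%:E).
Proof.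
move=> F0 mF; rewrite (@tonelli_swap _ _ _ _ _ mu1 mu1
  (fun x u => F (x, u) * (c1 (u, y) * q (x, y))%:E)); last by meas.
  apply: eq_integral => x _; apply: eq_integral => u _.
  by rewrite -!(cd_c1_beta cd) mulrCA.
by move=> x u; rewrite mule_ge0// lee_fin mulr_ge0.
Qed.

Lemma KX_rev (F : T1 * T1 -> \bar R) : (forall p, 0 <= F p) ->
  measurable_fun setT F ->
  \int[w1]_x \int[KX x]_u F (x, u) = \int[w1]_x \int[KX x]_u F (u, x).
Proof.
move=> F0 mF.
have mF' : measurable_fun setT (fun p : T1 * T1 => F (p.2, p.1)) by meas.
rewrite (integral_w1_KX F0 mF) (integral_w1_KX (fun p => F0 (p.2, p.1)) mF').
by apply: eq_integral => y _; exact: integral_swap_fiber.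
Qed.

(** Insert [m] by [(a - b) ^ 2 <= 2 (a - m) ^ 2 + 2 (b - m) ^ 2]. Both terms have the same integral
    [I1] by exchangeability on the fibre, and integrating out the other variable costs a factor at
    most 1. *)
Lemma fiber_variance_le (h : T1 -> R) (m : R) y : measurable_fun setT h ->
  \int[mu1]_x \int[mu1]_u (((h x - h u) ^+ 2)%:E * (c1 (u, y) * q (x, y))%:E) <=
  4%:E * \int[mu1]_x (((h x - m) ^+ 2)%:E * (q (x, y))%:E).
Proof.
move=> mh; pose c x u := (c1 (u, y) * q (x, y))%:E.
have c0 x u : 0 <= c x u by rewrite lee_fin mulr_ge0.
have s0 x : 0 <= ((h x - m) ^+ 2)%:E by rewrite lee_fin sqr_ge0.
pose I1 := \int[mu1]_x \int[mu1]_u (((h x - m) ^+ 2)%:E * c x u).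
have I1_le : I1 <= \int[mu1]_x (((h x - m) ^+ 2)%:E * (q (x, y))%:E).
  apply: ge0_le_integral => //.
  - by move=> x _; apply: integral_ge0 => u _; rewrite mule_ge0.
  - apply: (@measurable_integral_snd _ _ _ _ _ mu1 (fun x u => ((h x - m) ^+ 2)%:E * c x u)).
      by move=> x u; rewrite mule_ge0.
    by rewrite /c; meas.
  - by meas.
  - move=> x _; rewrite ge0_integralZl//; last by rewrite /c; meas.
    rewrite lee_wpmul2l// /c; under eq_integral do rewrite EFinM.
    rewrite ge0_integralZr ?lee_fin//; last 2 first.
    + by meas.
    + by move=> u _; rewrite lee_fin.
    rewrite -[leRHS]mul1e lee_wpmul2r ?lee_fin//; exact: cd_c1_le1 cd y.
have I2E : \int[mu1]_x \int[mu1]_u (((h u - m) ^+ 2)%:E * c x u) = I1.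
  have ms : measurable_fun setT (fun p : T1 * T1 => ((h p.1 - m) ^+ 2)%:E) by meas.
  exact/esym/(integral_swap_fiber y (fun p => s0 p.1) ms).
apply: (@le_trans _ _ (2%:E * I1 + 2%:E * I1)); last first.
  rewrite -ge0_muleDl ?lee_fin// -EFinD (_ : 2 + 2 = 4)%R; last by ring.
  by rewrite lee_wpmul2l ?lee_fin.
rewrite -[X in _ + 2%:E * X]I2E.
have m1 : measurable_fun setT (fun p : T1 * T1 =>
   ((h p.1 - h p.2) ^+ 2)%:E * (c1 (p.2, y) * q (p.1, y))%:E) by meas.
have m2 : measurable_fun setT (fun p : T1 * T1 =>
   ((h p.1 - m) ^+ 2)%:E * (c1 (p.2, y) * q (p.1, y))%:E) by meas.
have m3 : measurable_fun setT (fun p : T1 * T1 =>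
   ((h p.2 - m) ^+ 2)%:E * (c1 (p.2, y) * q (p.1, y))%:E) by meas.
have cs0 (r : R) x u : 0 <= (r ^+ 2)%:E * c x u.
  by rewrite mule_ge0// lee_fin sqr_ge0.
apply: (@ge0_le_integral_lin _ _ _ mu1 2 2 (fun x => \int[mu1]_u (((h x - h u) ^+ 2)%:E * c x u))
  (fun x => \int[mu1]_u (((h x - m) ^+ 2)%:E * c x u))
  (fun x => \int[mu1]_u (((h u - m) ^+ 2)%:E * c x u))).
- by [].
- by [].
- exact: (@measurable_integral_snd _ _ _ _ _ mu1
    (fun x u => ((h x - h u) ^+ 2)%:E * c x u) (fun x u => cs0 _ x u) m1).
- exact: (@measurable_integral_snd _ _ _ _ _ mu1
    (fun x u => ((h x - m) ^+ 2)%:E * c x u) (fun x u => cs0 _ x u) m2).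
- exact: (@measurable_integral_snd _ _ _ _ _ mu1
    (fun x u => ((h u - m) ^+ 2)%:E * c x u) (fun x u => cs0 _ x u) m3).
- by move=> x; apply: integral_ge0 => u _; exact: cs0.
- by move=> x; apply: integral_ge0 => u _; exact: cs0.
- by move=> x; apply: integral_ge0 => u _; exact: cs0.
move=> x; apply: (@ge0_le_integral_lin _ _ _ mu1 2 2 (fun u => ((h x - h u) ^+ 2)%:E * c x u)
  (fun u => ((h x - m) ^+ 2)%:E * c x u) (fun u => ((h u - m) ^+ 2)%:E * c x u)).
- by [].
- by [].
- exact: (measurable_fun_pairl x m1).
- exact: (measurable_fun_pairl x m2).
- exact: (measurable_fun_pairl x m3).
- by move=> u; exact: cs0.
- by move=> u; exact: cs0.
- by move=> u; exact: cs0.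
move=> u; rewrite -!EFinM -EFinD lee_fin -subr_ge0.
rewrite (_ : (_ - _ = (h x - m + (h u - m)) ^+ 2 * (c1 (u, y) * q (x, y)))%R); last by ring.
by rewrite mulr_ge0 ?sqr_ge0// mulr_ge0.
Qed.

(** E (h(X) - m(Y))^2, which is E Var(h(X) | Y) when [m] is the conditional mean. Leaving [m] free
    makes the quantity symmetric under exchange of the coordinates. *)
Definition joint_variance (h : T1 -> R) (m : T2 -> R) : \bar R :=
  \int[mu2]_y \int[mu1]_x (((h x - m y) ^+ 2)%:E * (q (x, y))%:E).

Lemma integral_fiber_variance_le (h : T1 -> R) (m : T2 -> R) :
  measurable_fun setT h -> measurable_fun setT m ->
  \int[mu2]_y \int[mu1]_x \int[mu1]_u
    (((h x - h u) ^+ 2)%:E * (c1 (u, y) * q (x, y))%:E) <=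
  4%:E * joint_variance h m.
Proof.
move=> mh mm; rewrite -ge0_integralZl//; last 2 first.
- apply: (@measurable_integral_snd _ _ _ _ _ mu1 (fun y x =>
    ((h x - m y) ^+ 2)%:E * (q (x, y))%:E)); last by meas.
  by move=> y x; rewrite mule_ge0 ?lee_fin ?sqr_ge0.
- move=> y _; apply: integral_ge0 => x _.
  by rewrite mule_ge0 ?lee_fin ?sqr_ge0.
apply: ge0_le_integral => //.
- move=> y _; apply: integral_ge0 => x _; apply: integral_ge0 => u _.
  by rewrite mule_ge0 ?lee_fin ?sqr_ge0 ?mulr_ge0.
- apply: (@measurable_integral_snd _ _ _ _ _ mu1 (fun y x => \int[mu1]_u
    (((h x - h u) ^+ 2)%:E * (c1 (u, y) * q (x, y))%:E))).
    move=> y x; apply: integral_ge0 => u _.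
    by rewrite mule_ge0 ?lee_fin ?sqr_ge0 ?mulr_ge0.
  apply: (@measurable_integral_snd _ _ _ _ _ mu1 (fun (p : T2 * T1) u =>
    ((h p.2 - h u) ^+ 2)%:E * (c1 (u, p.1) * q (p.2, p.1))%:E)); last by meas.
  by move=> p u; rewrite mule_ge0 ?lee_fin ?sqr_ge0 ?mulr_ge0.
- apply: emeasurable_funM => //.
  apply: (@measurable_integral_snd _ _ _ _ _ mu1 (fun y x =>
    ((h x - m y) ^+ 2)%:E * (q (x, y))%:E)); last by meas.
  by move=> y x; rewrite mule_ge0 ?lee_fin ?sqr_ge0.
- by move=> y _; exact: fiber_variance_le.
Qed.

Lemma dirichlet_KX_le (h : T1 -> R) (m : T2 -> R) :
  measurable_fun setT h -> measurable_fun setT m ->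
  dirichlet w1 KX h <= 4%:E * joint_variance h m.
Proof.
move=> mh mm; apply: le_trans (integral_fiber_variance_le mh mm).
have F0 (p : T1 * T1) : 0 <= ((h p.1 - h p.2) ^+ 2)%:E by rewrite lee_fin sqr_ge0.
have mF : measurable_fun setT (fun p : T1 * T1 => ((h p.1 - h p.2) ^+ 2)%:E) by meas.
by rewrite /dirichlet (integral_w1_KX F0 mF).
Qed.

End reversible.

End gibbs_kernels.

Section pushforward_measure.
Context d d' (T1 : measurableType d) (T2 : measurableType d') (R : realType).
Variables (m : {measure set T1 -> \bar R}) (f : T1 -> T2).
Hypothesis mf : measurable_fun setT f.

Definition mpush : {measure set T2 -> \bar R}.
Proof. by refine (pushforward m f : {measure set T2 -> \bar R}); exact: mf. Defined.

Lemma ge0_integral_mpush (g : T2 -> \bar R) : (forall y, 0 <= g y) ->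
  measurable_fun setT g -> \int[mpush]_y g y = \int[m]_x g (f x).
Proof. by move=> g0 mg; rewrite ge0_integral_pushforward. Qed.

End pushforward_measure.

(** * The random scan sampler *)

Section random_scan.
Context d1 d2 (T1 : measurableType d1) (T2 : measurableType d2) (R : realType).
Variables (X : set T1) (Y : set T2).
Variables (mu1 : {sigma_finite_measure set T1 -> \bar R})
          (mu2 : {sigma_finite_measure set T2 -> \bar R}).
Variables (c1 c2 q : T1 * T2 -> R) (alpha : T1 -> R) (beta : T2 -> R).
Hypothesis cd : conditional_densities X Y mu1 mu2 c1 c2 q alpha beta.
Variables (p1 p2 : {nonneg R}).
Hypothesis p12 : (p1%:num + p2%:num = 1)%R.

Let mc1 := cd_mc1 cd.
Let mc2 := cd_mc2 cd.
Let mq := cd_mq cd.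
Let c1_ge0 := cd_c1_ge0 cd.
Let c2_ge0 := cd_c2_ge0 cd.

Let q_ge0 p : (0 <= q p)%R.
Proof. by case: p => x y; rewrite -(cd_c1_beta cd) mulr_ge0// (cd_beta_ge0 cd). Qed.

Let c1E_ge0 y x : 0 <= (c1 (x, y))%:E. Proof. by rewrite lee_fin. Qed.
Let c2E_ge0 x y : 0 <= (c2 (x, y))%:E. Proof. by rewrite lee_fin. Qed.
Let mc1E y : measurable_fun setT (fun x => (c1 (x, y))%:E). Proof. by meas. Qed.
Let mc2E x : measurable_fun setT (fun y => (c2 (x, y))%:E). Proof. by meas. Qed.
Let mpairr (y : T2) : measurable_fun setT (fun x : T1 => (x, y)).
Proof. by meas. Qed.
Let mpairl (x : T1) : measurable_fun setT (fun y : T2 => (x, y)).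
Proof. by meas. Qed.

(** Each summand is the conditional law of one coordinate, carried to the fibre through [z] on which
    the other coordinate is frozen. *)
Definition KR (z : T1 * T2) : {measure set (T1 * T2) -> \bar R} :=
  measure_add
    (mscale p1 (mpush (mdens mu1 (c1E_ge0 z.2) (mc1E z.2)) (mpairr z.2)))
    (mscale p2 (mpush (mdens mu2 (c2E_ge0 z.1) (mc2E z.1)) (mpairl z.1))).

Lemma integral_KR z (f : T1 * T2 -> \bar R) : (forall u, 0 <= f u) ->
  measurable_fun setT f -> \int[KR z]_u f u =
  p1%:num%:E * \int[mu1]_u (f (u, z.2) * (c1 (u, z.2))%:E) +
  p2%:num%:E * \int[mu2]_v (f (z.1, v) * (c2 (z.1, v))%:E).
Proof.
move=> f0 mf; rewrite ge0_integral_measure_add// !ge0_integral_mscale//.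
rewrite !ge0_integral_mpush//.
rewrite (@ge0_integral_density _ _ _ mu1 _ (c1E_ge0 z.2) (mc1E z.2))//; last by meas.
by rewrite (@ge0_integral_density _ _ _ mu2 _ (c2E_ge0 z.1) (mc2E z.1))//; meas.
Qed.

Lemma KR_setT z : KR z setT = p1%:num%:E * \int[mu1]_u (c1 (u, z.2))%:E +
  p2%:num%:E * \int[mu2]_v (c2 (z.1, v))%:E.
Proof.
rewrite -[LHS]mul1e -[LHS]integral_cst// integral_KR//.
by congr (_ * _ + _ * _); apply: eq_integral => u _; rewrite mul1e.
Qed.

Lemma KR_le1 z : KR z setT <= 1.
Proof.
rewrite KR_setT (_ : 1 = p1%:num%:E * 1 + p2%:num%:E * 1).
  apply: leeD; rewrite lee_wpmul2l ?lee_fin//.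
    exact: cd_c1_le1 cd z.2.
  exact: cd_c2_le1 cd z.1.
by rewrite !mule1 -EFinD p12.
Qed.

Lemma KR_markov z : (X `*` Y) z -> KR z setT = 1.
Proof.
move=> [Xz Yz]; rewrite KR_setT (cd_c1_eq1 cd Yz) (cd_c2_eq1 cd Xz).
by rewrite !mule1 -EFinD p12.
Qed.

Section measurability.
Variable F : (T1 * T2) * (T1 * T2) -> \bar R.
Hypotheses (F0 : forall p, 0 <= F p) (mF : measurable_fun setT F).

Let measurable_l : measurable_fun setT
  (fun z => \int[mu1]_u (F (z, (u, z.2)) * (c1 (u, z.2))%:E)).
Proof.
apply: (@measurable_integral_snd _ _ _ _ _ mu1
  (fun (z : T1 * T2) u => F (z, (u, z.2)) * (c1 (u, z.2))%:E)); last by meas.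
by move=> z u; rewrite mule_ge0.
Qed.

Let measurable_r : measurable_fun setT
  (fun z => \int[mu2]_v (F (z, (z.1, v)) * (c2 (z.1, v))%:E)).
Proof.
apply: (@measurable_integral_snd _ _ _ _ _ mu2
  (fun (z : T1 * T2) v => F (z, (z.1, v)) * (c2 (z.1, v))%:E)); last by meas.
by move=> z u; rewrite mule_ge0.
Qed.

Let integral_KRE z : \int[KR z]_u F (z, u) =
  p1%:num%:E * \int[mu1]_u (F (z, (u, z.2)) * (c1 (u, z.2))%:E) +
  p2%:num%:E * \int[mu2]_v (F (z, (z.1, v)) * (c2 (z.1, v))%:E).
Proof.
by apply: (@integral_KR z (fun u => F (z, u))) => //; meas.
Qed.

Lemma measurable_KR : measurable_fun setT (fun z => \int[KR z]_u F (z, u)).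
Proof.
by under eq_fun do rewrite integral_KRE; apply: emeasurable_funD;
  apply: emeasurable_funM.
Qed.

Variable w : probability (T1 * T2)%type R.
Hypothesis wE : forall A, measurable A -> w A = \int[mu1 \x mu2]_(z in A) (q z)%:E.

Lemma integral_w_KR : \int[w]_z \int[KR z]_u F (z, u) =
  p1%:num%:E * \int[mu2]_y \int[mu1]_x \int[mu1]_u
    (F ((x, y), (u, y)) * (c1 (u, y) * q (x, y))%:E) +
  p2%:num%:E * \int[mu1]_x \int[mu2]_y \int[mu2]_v
    (F ((x, y), (x, v)) * (c2 (x, v) * q (x, y))%:E).
Proof.
have qE0 z : 0 <= (q z)%:E by rewrite lee_fin.
have mqE : measurable_fun setT (fun z => (q z)%:E) by meas.
have wI := ge0_integral_density qE0 mqE wE.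
under eq_integral do rewrite integral_KRE.
have l0 z : 0 <= \int[mu1]_u (F (z, (u, z.2)) * (c1 (u, z.2))%:E).
  by apply: integral_ge0 => u _; rewrite mule_ge0.
have r0 z : 0 <= \int[mu2]_v (F (z, (z.1, v)) * (c2 (z.1, v))%:E).
  by apply: integral_ge0 => u _; rewrite mule_ge0.
rewrite ge0_integralD//; last 4 first.
- by move=> z _; rewrite mule_ge0 ?lee_fin.
- exact: emeasurable_funM.
- by move=> z _; rewrite mule_ge0 ?lee_fin.
- exact: emeasurable_funM.
rewrite !ge0_integralZl ?lee_fin//; congr (_ * _ + _ * _).
- rewrite wI// (fubini_tonelli2 (fun z =>
    \int[mu1]_u (F (z, (u, z.2)) * (c1 (u, z.2))%:E) * (q z)%:E)); last 2 first.
  + exact: emeasurable_funM.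
  + by move=> z; rewrite mule_ge0.
  apply: eq_integral => y _; apply: eq_integral => x _.
  rewrite -ge0_integralZr//; last 2 first.
  + by meas.
  + by move=> u _; rewrite mule_ge0.
  by apply: eq_integral => u _; rewrite -muleA -EFinM.
- rewrite wI// (fubini_tonelli1 (fun z =>
    \int[mu2]_v (F (z, (z.1, v)) * (c2 (z.1, v))%:E) * (q z)%:E)); last 2 first.
  + exact: emeasurable_funM.
  + by move=> z; rewrite mule_ge0.
  apply: eq_integral => x _; apply: eq_integral => y _.
  rewrite -ge0_integralZr//; last 2 first.
  + by meas.
  + by move=> u _; rewrite mule_ge0.
  by apply: eq_integral => u _; rewrite -muleA -EFinM.
Qed.

End measurability.

Variable w : probability (T1 * T2)%type R.
Hypothesis wE : forall A, measurable A -> w A = \int[mu1 \x mu2]_(z in A) (q z)%:E.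
Hypothesis wXY : w (X `*` Y) = 1.

Lemma KR_markov_ae : {ae w, forall z, KR z setT = 1}.
Proof.
have mXY : measurable (X `*` Y) by apply: measurableX; [exact: cd_mX cd|exact: cd_mY cd].
exists (~` (X `*` Y)); split; first exact: measurableC.
  by rewrite probability_setC// wXY subee.
by move=> z /= KRz XYz; apply: KRz; exact: KR_markov.
Qed.

Lemma KR_rev (F : (T1 * T2) * (T1 * T2) -> \bar R) : (forall p, 0 <= F p) ->
  measurable_fun setT F ->
  \int[w]_z \int[KR z]_u F (z, u) = \int[w]_z \int[KR z]_u F (u, z).
Proof.
move=> F0 mF.
have mF' : measurable_fun setT (fun p : (T1 * T2) * (T1 * T2) => F (p.2, p.1)).
  exact: measurable_fun_swap.
rewrite (integral_w_KR F0 mF wE) (integral_w_KR (fun p => F0 (p.2, p.1)) mF' wE).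
have m1 y : measurable_fun setT (fun p : T1 * T1 => F ((p.1, y), (p.2, y))) by meas.
have m2 x : measurable_fun setT (fun p : T2 * T2 => F ((x, p.1), (x, p.2))) by meas.
have E1 y := integral_swap_fiber cd y (fun p => F0 ((p.1, y), (p.2, y))) (m1 y).
have E2 x := integral_swap_fiber (conditional_densities_swap cd) x
  (fun p => F0 ((x, p.1), (x, p.2))) (m2 x).
rewrite (eq_integral _ _ (fun y _ => E1 y)) (eq_integral _ _ (fun x _ => E2 x)).
by [].
Qed.

(** A Y-update leaves [h z.1] unchanged and contributes nothing; the X-update contributes the same
    fibre integral as the marginal chain, with a weight [p1 <= 1]. *)
Lemma dirichlet_KR_le (h : T1 -> R) (m : T2 -> R) :
  measurable_fun setT h -> measurable_fun setT m ->
  dirichlet w KR (fun z => h z.1) <= 4%:E * joint_variance mu1 mu2 q h m.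
Proof.
move=> mh mm; apply: le_trans (integral_fiber_variance_le cd mh mm).
have F0 (p : (T1 * T2) * (T1 * T2)) : 0 <= ((h p.1.1 - h p.2.1) ^+ 2)%:E.
  by rewrite lee_fin sqr_ge0.
have mF : measurable_fun setT
    (fun p : (T1 * T2) * (T1 * T2) => ((h p.1.1 - h p.2.1) ^+ 2)%:E).
  by meas.
rewrite /dirichlet (integral_w_KR F0 mF wE)/=.
under [X in _ + _ * X]eq_integral => x _.
  under eq_integral => y _.
    under eq_integral do rewrite subrr expr0n/= mul0e.
    rewrite integral0; over.
  rewrite integral0; over.
rewrite integral0 mule0 adde0 -[leRHS]mul1e lee_wpmul2r//.
  apply: integral_ge0 => y _; apply: integral_ge0 => x _; apply: integral_ge0 => u _.
  by rewrite mule_ge0 ?lee_fin ?sqr_ge0 ?mulr_ge0.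
by rewrite lee_fin -p12 lerDl.
Qed.

End random_scan.

(** * Marginals of the joint law *)

Section marginals.
Context d1 d2 (T1 : measurableType d1) (T2 : measurableType d2) (R : realType).
Variables (X : set T1) (Y : set T2).
Variables (mu1 : {sigma_finite_measure set T1 -> \bar R})
          (mu2 : {sigma_finite_measure set T2 -> \bar R}).
Variables (c1 c2 q : T1 * T2 -> R) (alpha : T1 -> R) (beta : T2 -> R).
Hypothesis cd : conditional_densities X Y mu1 mu2 c1 c2 q alpha beta.

Let mc1 := cd_mc1 cd.
Let mc2 := cd_mc2 cd.
Let mq := cd_mq cd.
Let c1_ge0 := cd_c1_ge0 cd.
Let c2_ge0 := cd_c2_ge0 cd.

Lemma joint_density_ge0 p : (0 <= q p)%R.
Proof. by case: p => x y; rewrite -(cd_c1_beta cd) mulr_ge0// (cd_beta_ge0 cd). Qed.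
Let q_ge0 := joint_density_ge0.

Lemma integral_joint_density_snd x : \int[mu2]_y (q (x, y))%:E = (alpha x)%:E.
Proof.
under eq_integral do rewrite -(cd_c2_alpha cd) mulrC EFinM.
have a0 := cd_alpha_ge0 cd x.
rewrite ge0_integralZl//; last 2 first.
- by meas.
- by move=> y _; rewrite lee_fin.
have [Xx|Xx] := pselect (X x); first by rewrite (cd_c2_eq1 cd Xx) mule1.
by rewrite (cd_alpha_out cd Xx) mul0e.
Qed.

Lemma integral_joint_density_fst y : \int[mu1]_x (q (x, y))%:E = (beta y)%:E.
Proof.
under eq_integral do rewrite -(cd_c1_beta cd) mulrC EFinM.
have b0 := cd_beta_ge0 cd y.
rewrite ge0_integralZl//; last 2 first.
- by meas.
- by move=> x _; rewrite lee_fin.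
have [Yy|Yy] := pselect (Y y); first by rewrite (cd_c1_eq1 cd Yy) mule1.
by rewrite (cd_beta_out cd Yy) mul0e.
Qed.

Variable w : probability (T1 * T2)%type R.
Hypothesis wE : forall A, measurable A -> w A = \int[mu1 \x mu2]_(z in A) (q z)%:E.

Lemma integral_joint (f : T1 * T2 -> \bar R) : (forall z, 0 <= f z) ->
  measurable_fun setT f ->
  \int[w]_z f z = \int[mu1 \x mu2]_z (f z * (q z)%:E).
Proof.
by move=> f0 mf; apply: ge0_integral_density => //; meas.
Qed.

Lemma integral_joint12 (f : T1 * T2 -> \bar R) : (forall z, 0 <= f z) ->
  measurable_fun setT f ->
  \int[w]_z f z = \int[mu1]_x \int[mu2]_y (f (x, y) * (q (x, y))%:E).
Proof.
move=> f0 mf; rewrite integral_joint// (fubini_tonelli1 (fun z => f z * (q z)%:E))//.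
  by meas.
by move=> z; rewrite mule_ge0// lee_fin.
Qed.

Lemma integral_joint21 (f : T1 * T2 -> \bar R) : (forall z, 0 <= f z) ->
  measurable_fun setT f ->
  \int[w]_z f z = \int[mu2]_y \int[mu1]_x (f (x, y) * (q (x, y))%:E).
Proof.
move=> f0 mf; rewrite integral_joint// (fubini_tonelli2 (fun z => f z * (q z)%:E))//.
  by meas.
by move=> z; rewrite mule_ge0// lee_fin.
Qed.

Lemma integral_joint_snd (f : T2 -> \bar R) : (forall y, 0 <= f y) ->
  measurable_fun setT f ->
  \int[w]_z f z.2 = \int[mu2]_y (f y * (beta y)%:E).
Proof.
move=> f0 mf; rewrite (@integral_joint21 (fun z => f z.2))//; last by meas.
apply: eq_integral => y _ /=; rewrite -integral_joint_density_fst ge0_integralZl//.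
  by meas.
by move=> x _; rewrite lee_fin.
Qed.

Lemma integral_joint_fst (f : T1 -> \bar R) : (forall x, 0 <= f x) ->
  measurable_fun setT f ->
  \int[w]_z f z.1 = \int[mu1]_x (f x * (alpha x)%:E).
Proof.
move=> f0 mf; rewrite (@integral_joint12 (fun z => f z.1))//; last by meas.
apply: eq_integral => x _ /=; rewrite -integral_joint_density_snd ge0_integralZl//.
  by meas.
by move=> y _; rewrite lee_fin.
Qed.

Lemma measure_joint_fst A : measurable A ->
  w (A `*` setT) = \int[mu1]_(x in A) (alpha x)%:E.
Proof.
move=> mA; have mA1 : measurable_fun setT (fun x => (\1_A x : R)%:E) by meas.
have -> : w (A `*` setT) = \int[w]_z (\1_A z.1 : R)%:E.
  transitivity (\int[w]_z (\1_(A `*` setT) z : R)%:E).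
    by rewrite integral_indic ?setIT//; exact: measurableX.
  apply: eq_integral => z _; rewrite !indicE; congr ((nat_of_bool _)%:R%:E); apply/idP/idP.
    by rewrite !inE => -[].
  by rewrite !inE.
rewrite (@integral_joint_fst (fun x => (\1_A x : R)%:E))//.
rewrite [RHS]integral_mkcond; apply: eq_integral => x _.
by rewrite patchE indicE; case: ifPn; rewrite ?mul1e ?mul0e.
Qed.

Lemma measure_joint_snd B : measurable B ->
  w (setT `*` B) = \int[mu2]_(y in B) (beta y)%:E.
Proof.
move=> mB; have mB1 : measurable_fun setT (fun y => (\1_B y : R)%:E) by meas.
have -> : w (setT `*` B) = \int[w]_z (\1_B z.2 : R)%:E.
  transitivity (\int[w]_z (\1_(setT `*` B) z : R)%:E).
    by rewrite integral_indic ?setIT//; exact: measurableX.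
  apply: eq_integral => z _; rewrite !indicE; congr ((nat_of_bool _)%:R%:E); apply/idP/idP.
    by rewrite !inE => -[].
  by rewrite !inE.
rewrite (@integral_joint_snd (fun y => (\1_B y : R)%:E))//.
rewrite [RHS]integral_mkcond; apply: eq_integral => y _.
by rewrite patchE indicE; case: ifPn; rewrite ?mul1e ?mul0e.
Qed.

Lemma joint_varianceE (h : T1 -> R) (m : T2 -> R) :
  measurable_fun setT h -> measurable_fun setT m ->
  joint_variance mu1 mu2 q h m = \int[w]_z ((h z.1 - m z.2) ^+ 2)%:E.
Proof.
move=> mh mm.
have F0 (z : T1 * T2) : 0 <= ((h z.1 - m z.2) ^+ 2)%:E by rewrite lee_fin sqr_ge0.
have mF : measurable_fun setT (fun z : T1 * T2 => ((h z.1 - m z.2) ^+ 2)%:E) by meas.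
by rewrite (integral_joint21 F0 mF).
Qed.

(** After exchanging the coordinates, [m] is the function and [h] its approximation, with the same
    mean square distance. Hence one bound controls the Dirichlet forms of both chains. *)
Lemma joint_variance_swapE (h : T1 -> R) (m : T2 -> R) :
  measurable_fun setT h -> measurable_fun setT m ->
  joint_variance mu2 mu1 (fun p => q (p.2, p.1)) m h =
  \int[w]_z ((h z.1 - m z.2) ^+ 2)%:E.
Proof.
move=> mh mm.
have F0 (z : T1 * T2) : 0 <= ((h z.1 - m z.2) ^+ 2)%:E by rewrite lee_fin sqr_ge0.
have mF : measurable_fun setT (fun z : T1 * T2 => ((h z.1 - m z.2) ^+ 2)%:E) by meas.
rewrite (integral_joint12 F0 mF) /joint_variance.
by apply: eq_integral => x _; apply: eq_integral => y _; rewrite -sqrrN opprB.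
Qed.

End marginals.

Lemma kernel_iter_ge0 d (T : measurableType d) (R : realType)
  (K : T -> {measure set T -> \bar R}) n z A : 0 <= kernel_iter K n z A.
Proof.
by elim: n z => [|n ih] z /=; [exact: measure_ge0|apply: integral_ge0].
Qed.

(** * The deterministic scan sampler and its Y-coordinate *)

Section deterministic_scan.
Context d1 d2 (T1 : measurableType d1) (T2 : measurableType d2) (R : realType).
Variables (X : set T1) (Y : set T2).
Variables (mu1 : {sigma_finite_measure set T1 -> \bar R})
          (mu2 : {sigma_finite_measure set T2 -> \bar R}).
Variables (c1 c2 q : T1 * T2 -> R) (alpha : T1 -> R) (beta : T2 -> R).
Hypothesis cd : conditional_densities X Y mu1 mu2 c1 c2 q alpha beta.

Let mc1 := cd_mc1 cd.
Let mc2 := cd_mc2 cd.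
Let c1_ge0 := cd_c1_ge0 cd.
Let c2_ge0 := cd_c2_ge0 cd.

Local Notation KY := (KX (conditional_densities_swap cd)).

Let rhoD_ge0 (y : T2) (z' : T1 * T2) : 0 <= (c1 (z'.1, y) * c2 (z'.1, z'.2))%:E.
Proof. by rewrite lee_fin mulr_ge0. Qed.

Let measurable_rhoD (y : T2) :
  measurable_fun setT (fun z' : T1 * T2 => (c1 (z'.1, y) * c2 (z'.1, z'.2))%:E).
Proof. by meas. Qed.

Definition KD (z : T1 * T2) : {measure set (T1 * T2) -> \bar R} :=
  mdens (mu1 \x mu2) (rhoD_ge0 z.2) (measurable_rhoD z.2).

(** [KD z] depends on [z] through [z.2] only, and integrating out the new X-coordinate leaves the
    transition density of the Y-chain. *)
Lemma integral_KD_snd z (g : T2 -> \bar R) : (forall y, 0 <= g y) ->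
  measurable_fun setT g -> \int[KD z]_u g u.2 = \int[KY z.2]_y g y.
Proof.
move=> g0 mg; rewrite integral_KX//.
rewrite (@ge0_integral_density _ _ _ (mu1 \x mu2) _ (rhoD_ge0 z.2)
  (measurable_rhoD z.2) _ (fun u => g u.2))//; last by meas.
rewrite (fubini_tonelli2 (fun u => g u.2 * (c1 (u.1, z.2) * c2 (u.1, u.2))%:E))//; last 2 first.
- by meas.
- by move=> u; rewrite mule_ge0// lee_fin mulr_ge0.
apply: eq_integral => y _; rewrite /rhoX -ge0_integralZl//; last 2 first.
- by rewrite /=; meas.
- by move=> x _; rewrite lee_fin mulr_ge0.
by apply: eq_integral => x _; rewrite /= [(c1 _ * _)%R]mulrC.
Qed.

Lemma measurable_kernel_iter_KY n B : measurable B ->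
  measurable_fun setT (fun y => kernel_iter KY n y B).
Proof.
move=> mB; elim: n => [|n ih] /=.
  by under eq_fun do rewrite diracE; apply/measurable_EFinP; exact: measurable_indic.
apply: (@measurable_KX _ _ _ _ _ _ _ _ _ _ _ _ _ _ (conditional_densities_swap cd)
  (fun p => kernel_iter KY n p.2 B)).
  by move=> p; exact: kernel_iter_ge0.
exact: (measurable_fun_snd ih).
Qed.

Lemma kernel_iter_KD n z B : measurable B ->
  kernel_iter KD n z (setT `*` B) = kernel_iter KY n z.2 B.
Proof.
move=> mB; elim: n z => [|n ih] z.
  rewrite /= !diracE; congr ((nat_of_bool _)%:R%:E); apply/idP/idP; last by rewrite !inE.
  by rewrite !inE => -[].
rewrite [LHS]/= -[RHS]/(\int[KY z.2]_y kernel_iter KY n y B) -integral_KD_snd.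
- by apply: eq_integral => u _; exact: ih.
- by move=> y; exact: kernel_iter_ge0.
- exact: measurable_kernel_iter_KY.
Qed.

(* The Y-coordinate of the deterministic scan sampler is itself a Markov chain,
   and it forgets the initial value of the X-coordinate. *)
Lemma geometrically_ergodic_KD (w : probability (T1 * T2)%type R)
    (w2 : probability T2 R) x0 : X x0 ->
  (forall B, measurable B -> w2 B = w (setT `*` B)) ->
  geometrically_ergodic (X `*` Y) w KD -> geometrically_ergodic Y w2 KY.
Proof.
move=> Xx0 w2E [M [t [t01 Mt]]]; exists (fun y => M (x0, y)), t; split => // y Yy n.
apply: le_trans (Mt (x0, y) (conj Xx0 Yy) n); apply: ge_ereal_sup => _ [B mB <-].
apply: ereal_sup_ubound; exists (setT `*` B); first exact: measurableX.
by rewrite kernel_iter_KD// w2E.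
Qed.

End deterministic_scan.

Lemma L2_01I d (T : measurableType d) (R : realType) (w : probability T R)
  (f : T -> R) : measurable_fun setT f -> \int[w]_z (f z)%:E = 0 ->
  \int[w]_z (f z ^+ 2)%:E = 1 -> L2_01 w f.
Proof.
move=> mf f1 f2; split; [|by rewrite unlock..].
rewrite inE; apply/andP; split; rewrite inE//= /finite_norm unlock poweR_lty//.
under eq_integral do rewrite poweR2_EFin.
by rewrite f2 ltry.
Qed.

Section snd_measurable.
Context d1 d2 (T1 : measurableType d1) (T2 : measurableType d2).

HB.instance Definition _ := isMeasurableFun.Build _ _ _ _
  (@snd T1 T2) measurable_snd.

End snd_measurable.

(** * Norms and subgeometric ergodicity of the three samplers *)

Section gibbs_samplers.
Context d1 d2 (T1 : measurableType d1) (T2 : measurableType d2) (R : realType).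
Variables (X : set T1) (Y : set T2).
Variables (mu1 : {sigma_finite_measure set T1 -> \bar R})
          (mu2 : {sigma_finite_measure set T2 -> \bar R}).
Variables (c1 c2 q : T1 * T2 -> R) (alpha : T1 -> R) (beta : T2 -> R).
Hypothesis cd : conditional_densities X Y mu1 mu2 c1 c2 q alpha beta.
Variable w : probability (T1 * T2)%type R.
Hypothesis wE : forall A, measurable A -> w A = \int[mu1 \x mu2]_(z in A) (q z)%:E.
Hypothesis wXY : w (X `*` Y) = 1.
(** The form in which the assumption on the limit inferior is used; [m] will be the conditional mean
    of [h]. *)
Hypothesis small : forall e : R, (0 < e)%R -> exists h m,
  [/\ L2_01 (distribution w fst) h, measurable_fun setT m &
      joint_variance mu1 mu2 q h m <= e%:E].

Let mX := cd_mX cd.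
Let mY := cd_mY cd.
Local Notation w1 := (distribution w fst).

Let w1E A : measurable A -> w1 A = \int[mu1]_(x in A) (alpha x)%:E.
Proof.
move=> mA; rewrite -(measure_joint_fst cd wE mA); congr (w _).
by apply/seteqP; split => [z//|z []].
Qed.

Let w1X : w1 X = 1.
Proof.
apply/eqP; rewrite eq_le probability_le1//= -wXY le_measure ?inE//.
- exact: measurableX.
- by rewrite -[_ @^-1` _]setTI; exact: measurable_fst.
- by move=> z [].
Qed.

Let small_KX (e : R) : (0 < e)%R ->
  exists2 f, L2_01 w1 f & dirichlet w1 (KX cd) f <= e%:E.
Proof.
move=> e0; have [h [m [h01 mm hm]]] := small (divr_gt0 e0 (ltr0n R 4)).
exists h => //; have [mh _] := L2_01P h01.
apply: le_trans (dirichlet_KX_le cd w1E mh mm) _.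
apply: (@le_trans _ _ (4%:E * (e / 4)%:E)); first by rewrite lee_wpmul2l ?lee_fin.
by rewrite -EFinM mulrC divfK.
Qed.

Lemma kernel_norm_KX : kernel_norm w1 (KX cd) = 1.
Proof.
exact (kernel_norm_eq1 (KX_le1 cd) (measurable_KX cd) (KX_rev cd w1E)
  (KX_markov_ae cd w1X) small_KX).
Qed.

Lemma subgeometric_KX : subgeometrically_ergodic X w1 (KX cd).
Proof.
exact (subgeometric_of_dirichlet (KX_le1 cd) (measurable_KX cd) (KX_rev cd w1E)
  (KX_markov_ae cd w1X) mX w1X small_KX).
Qed.

Let L2_01_fst h : L2_01 w1 h -> L2_01 w (fun z => h z.1).
Proof.
move=> h01; have [mh h2] := L2_01P h01.
have mh1 : measurable_fun setT (fun z : T1 * T2 => h z.1) by meas.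
have h2w : \int[w]_z (h z.1 ^+ 2)%:E = 1.
  rewrite -h2 (@ge0_integral_distribution _ _ _ _ _ w fst (fun x => (h x ^+ 2)%:E))//.
    exact: measurable_sqr_EFin.
  by move=> x; rewrite lee_fin sqr_ge0.
apply: L2_01I => //; case: h01 => _; rewrite unlock => h1 _.
rewrite -[RHS]h1 (@integral_distribution _ _ _ _ _ w fst (EFin \o h))//.
  exact/measurable_EFinP.
have wT : w setT <= 1 by rewrite probability_setT.
by apply: (integrable_of_sqr wT mh1); rewrite h2w ltry.
Qed.

Section random_scan_sampler.
Variables (p1 p2 : {nonneg R}).
Hypothesis p12 : (p1%:num + p2%:num = 1)%R.

Let small_KR (e : R) : (0 < e)%R ->
  exists2 f, L2_01 w f & dirichlet w (KR cd p1 p2) f <= e%:E.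
Proof.
move=> e0; have [h [m [h01 mm hm]]] := small (divr_gt0 e0 (ltr0n R 4)).
exists (fun z => h z.1); first exact: L2_01_fst.
have [mh _] := L2_01P h01.
apply: le_trans (dirichlet_KR_le cd p12 wE mh mm) _.
apply: (@le_trans _ _ (4%:E * (e / 4)%:E)); first by rewrite lee_wpmul2l ?lee_fin.
by rewrite -EFinM mulrC divfK.
Qed.

Lemma kernel_norm_KR : kernel_norm w (KR cd p1 p2) = 1.
Proof.
exact (kernel_norm_eq1 (KR_le1 cd p12)
  (@measurable_KR _ _ _ _ _ _ _ _ _ _ _ _ _ _ cd p1 p2)
  (KR_rev cd p1 p2 wE) (KR_markov_ae cd p12 wXY) small_KR).
Qed.

Lemma subgeometric_KR : subgeometrically_ergodic (X `*` Y) w (KR cd p1 p2).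
Proof.
exact (subgeometric_of_dirichlet (KR_le1 cd p12)
  (@measurable_KR _ _ _ _ _ _ _ _ _ _ _ _ _ _ cd p1 p2)
  (KR_rev cd p1 p2 wE) (KR_markov_ae cd p12 wXY) (measurableX mX mY) wXY small_KR).
Qed.

End random_scan_sampler.

(* If the Y-chain had a Poincare inequality, m(Y) would be close to a constant
   in mean square, hence so would h(X). *)
Lemma subgeometric_KD : subgeometrically_ergodic (X `*` Y) w (KD cd).
Proof.
pose w2 : probability T2 R := distribution w snd; pose KY := KX (conditional_densities_swap cd).
have cd' := conditional_densities_swap cd.
(* A starting point for the X-coordinate, needed to restrict the ergodicity bound to the
   Y-coordinate. *)
have [x0 Xx0] : X !=set0.
  apply/set0P/eqP => X0; have := w1X; rewrite X0 measure0 => /esym/eqP;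
  by rewrite gt_eqF.
have w2S B : measurable B -> w2 B = w (setT `*` B).
  by move=> mB; congr (w _); apply/seteqP; split => [z //|z []].
have w2E B : measurable B -> w2 B = \int[mu2]_(y in B) (beta y)%:E.
  by move=> mB; rewrite w2S// (measure_joint_snd cd wE mB).
have w2Y : w2 Y = 1.
  apply/eqP; rewrite eq_le probability_le1//= -wXY w2S// le_measure ?inE//.
  - exact: measurableX.
  - exact: measurableX.
  - by move=> z [].
move=> /(geometrically_ergodic_KD Xx0 w2S) geoY.
have [C C0 poincare] := geometric_poincare (KX_le1 cd') (measurable_KX cd')
  (KX_rev cd' w2E) (KX_markov_ae cd' w2Y) mY w2Y geoY.
have C1 : (0 < 1 + 4 * C)%R by rewrite addr_gt0// mulr_gt0.
(* Chosen so that [2 dl + 2 (C (4 dl) + 1/8) = 2 (1 + 4 C) dl + 1/4 = 1/2], which is below the bound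
   1 that [h] enforces. *)
pose dl := (8 * (1 + 4 * C))^-1%R.
have dl0 : (0 < dl)%R by rewrite invr_gt0 mulr_gt0.
have [h [m [h01 mm hm]]] := small dl0; have [mh h2] := L2_01P h01.
have [mh1 h21] := L2_01P (L2_01_fst h01).
have mm2 : measurable_fun setT (fun z : T1 * T2 => m z.2) by meas.
have Vw := joint_varianceE cd wE mh mm.
have w2I (f : T2 -> R) : measurable_fun setT f ->
    \int[w2]_y (f y ^+ 2)%:E = \int[w]_z (f z.2 ^+ 2)%:E.
  move=> mf; rewrite (@ge0_integral_distribution _ _ _ _ _ w snd (fun y => (f y ^+ 2)%:E))//.
    exact: measurable_sqr_EFin.
  by move=> y; rewrite lee_fin sqr_ge0.
have mhm : measurable_fun setT (fun z : T1 * T2 => h z.1 - m z.2)%R by meas.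
have mmh : measurable_fun setT (fun z : T1 * T2 => m z.2 - h z.1)%R by meas.
(* [m] is square integrable because it is close to [h] in mean square. *)
have m2y : \int[w2]_y (m y ^+ 2)%:E < +oo.
  have mE (z : T1 * T2) : (m z.2 = h z.1 + (m z.2 - h z.1))%R by ring.
  rewrite w2I// (le_lt_trans (le_integral_sqrD w mm2 mh1 mmh mE))// h21.
  under eq_integral do rewrite -sqrrN opprB.
  rewrite -Vw (@le_lt_trans _ _ (2%:E * 1 + 2%:E * dl%:E))//.
    by rewrite leeD2l// lee_wpmul2l ?lee_fin.
  by rewrite -!EFinM -EFinD ltry.
have e0 : (0 < 8^-1 :> R)%R by rewrite invr_gt0.
have [c mc] := poincare m mm m2y _ e0.
(* The Dirichlet estimate for the Y-chain, with [m] as the function and [h] as the centre. *)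
have D_le : dirichlet w2 KY m <= 4%:E * dl%:E.
  apply: le_trans (dirichlet_KX_le cd' w2E mm mh) _.
  by rewrite (joint_variance_swapE cd wE mh mm) -Vw lee_wpmul2l ?lee_fin.
have mmc : measurable_fun setT (fun z : T1 * T2 => m z.2 - c)%R by meas.
have mhc : measurable_fun setT (fun z : T1 * T2 => h z.1 - c)%R by meas.
have hE (z : T1 * T2) : (h z.1 - c = h z.1 - m z.2 + (m z.2 - c))%R by ring.
have := le_trans (L2_01_integral_center c (L2_01_fst h01))
  (le_integral_sqrD w mhc mhm mmc hE).
rewrite -Vw -(w2I (fun y => m y - c)%R); last exact: measurable_funB.
apply/negP; rewrite -ltNge.
apply: (@le_lt_trans _ _ (2%:E * dl%:E + 2%:E * (C%:E * (4%:E * dl%:E) + (8^-1)%:E))).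
  apply: leeD; rewrite lee_wpmul2l ?lee_fin//.
  by apply: (le_trans mc); rewrite leeD2r// lee_wpmul2l// lee_fin ltW.
rewrite -!EFinM -!EFinD lte_fin.
rewrite (_ : _ + _ = 2 * ((1 + 4 * C) * dl) + 4^-1)%R; last by field.
have -> : ((1 + 4 * C) * dl = 8^-1)%R by rewrite /dl; field; rewrite gt_eqF.
lra.
Qed.

End gibbs_samplers.

(** * Conditional densities of the joint density *)

Section normalized_density.
Context d (T : measurableType d) (R : realType) (mu : {measure set T -> \bar R}).
Variables (S : set T) (g : T -> R).
Hypotheses (mS : measurable S) (mg : measurable_fun setT g) (g0 : forall x, (0 <= g x)%R).

Let a := \int[mu]_(x in S) (g x)%:E.

Lemma integral_normalized :
  \int[mu]_x (\1_S x * (g x / fine a))%:E = (fine a)^-1%:E * a.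
Proof.
rewrite -ge0_integralZl//; last 3 first.
- by apply: measurable_funTS; exact/measurable_EFinP.
- by move=> x _; rewrite lee_fin.
- by rewrite lee_fin invr_ge0 fine_ge0// integral_ge0// => x _; rewrite lee_fin.
rewrite [RHS]integral_mkcond; apply: eq_integral => x _; rewrite patchE indicE.
by case: ifPn => _; rewrite ?mul1r ?mul0r// mulrC EFinM.
Qed.

(* For an infinite integral, [fine] yields [0] and so does the inverse of [0]. *)
Lemma integral_normalized_le1 : \int[mu]_x (\1_S x * (g x / fine a))%:E <= 1.
Proof.
rewrite integral_normalized.
have : 0 <= a by apply: integral_ge0 => x _; rewrite lee_fin.
case: a => [r|_|//] /=; last by rewrite invr0 mul0e lee01.
rewrite -EFinM lee_fin => r0; have [->|r1] := eqVneq r 0%R; first by rewrite mulr0.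
by rewrite mulVf.
Qed.

Lemma integral_normalized_eq1 : 0 < a < +oo ->
  \int[mu]_x (\1_S x * (g x / fine a))%:E = 1.
Proof.
rewrite integral_normalized; case: a => [r| |//] /=; last by rewrite ltxx andbF.
by rewrite lte_fin => /andP[r0 _]; rewrite -EFinM mulVf// gt_eqF.
Qed.

End normalized_density.

Lemma measurable_fun_inv_ge0 d (T : measurableType d) (R : realType) (f : T -> R) :
  (forall x, 0 <= f x)%R -> measurable_fun setT f ->
  measurable_fun setT (fun x => (f x)^-1)%R.
Proof.
move=> f0 mf; under eq_fun do rewrite -powR_inv1//.
exact: (measurableT_comp (measurable_powR _)).
Qed.

Section gibbs_densities.
Context d1 d2 (T1 : measurableType d1) (T2 : measurableType d2) (R : realType).
Variables (X : set T1) (Y : set T2) (mX : measurable X) (mY : measurable Y).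
Variables (muX : {sigma_finite_measure set T1 -> \bar R})
          (muY : {sigma_finite_measure set T2 -> \bar R}).
Variable dens : T1 * T2 -> R.
Hypotheses (dens_meas : measurable_fun setT dens) (dens_ge0 : forall z, (0 <= dens z)%R).
Hypothesis marginalX_gt0 : forall x, X x -> 0 < marginalX Y muY dens x < +oo.
Hypothesis marginalY_gt0 : forall y, Y y -> 0 < marginalY X muX dens y < +oo.

(** A conditional density is cut off in its own variable but not in the conditioning one, so that
    the kernels built from it agree with the given transition functions at every starting point. *)
Definition cut_condX (z : T1 * T2) : R := (\1_X z.1 * condX X muX dens z.1 z.2)%R.
Definition cut_condY (z : T1 * T2) : R := (\1_Y z.2 * condY Y muY dens z.2 z.1)%R.
Definition cut_dens (z : T1 * T2) : R := (\1_X z.1 * \1_Y z.2 * dens z)%R.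
Definition cut_marginalX (x : T1) : R := (\1_X x * fine (marginalX Y muY dens x))%R.
Definition cut_marginalY (y : T2) : R := (\1_Y y * fine (marginalY X muX dens y))%R.

Let mdX : measurable_fun setT (\1_X : T1 -> R). Proof. exact: measurable_indic. Qed.
Let mdY : measurable_fun setT (\1_Y : T2 -> R). Proof. exact: measurable_indic. Qed.

Let mmX : measurable_fun setT (fun x => fine (marginalX Y muY dens x)).
Proof.
apply: (measurableT_comp (f := fine)) => //.
rewrite (_ : marginalX Y muY dens = fun x => \int[muY]_y (\1_Y y * dens (x, y))%:E).
  apply: (@measurable_integral_snd _ _ _ _ _ muY (fun x y => (\1_Y y * dens (x, y))%:E)).
    by move=> x y; rewrite lee_fin mulr_ge0.
  by meas.
apply/funext => x; rewrite /marginalX integral_mkcond; apply: eq_integral => y _.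
by rewrite patchE indicE; case: ifPn => _; rewrite ?mul1r ?mul0r.
Qed.

Let mmY : measurable_fun setT (fun y => fine (marginalY X muX dens y)).
Proof.
apply: (measurableT_comp (f := fine)) => //.
rewrite (_ : marginalY X muX dens = fun y => \int[muX]_x (\1_X x * dens (x, y))%:E).
  apply: (@measurable_integral_snd _ _ _ _ _ muX (fun y x => (\1_X x * dens (x, y))%:E)).
    by move=> x y; rewrite lee_fin mulr_ge0.
  by meas.
apply/funext => y; rewrite /marginalY integral_mkcond; apply: eq_integral => x _.
by rewrite patchE indicE; case: ifPn => _; rewrite ?mul1r ?mul0r.
Qed.

Let fine_marginalX_ge0 x : (0 <= fine (marginalX Y muY dens x))%R.
Proof. by rewrite fine_ge0// integral_ge0// => y _; rewrite lee_fin. Qed.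

Let fine_marginalY_ge0 y : (0 <= fine (marginalY X muX dens y))%R.
Proof. by rewrite fine_ge0// integral_ge0// => x _; rewrite lee_fin. Qed.

(** On [X] and [Y] the marginals lie in ]0, +oo[, so [fine] loses nothing, the quotients cancel and
    the masses are 1; elsewhere the cut-off marginals vanish, and so does the cut-off joint
    density. *)
Lemma gibbs_conditional_densities : conditional_densities X Y muX muY
  cut_condX cut_condY cut_dens cut_marginalX cut_marginalY.
Proof.
have dX x y : measurable_fun setT (fun z : T1 * T2 => dens (z.1, z.2)) by meas.
split => //.
- apply: measurable_funM; first by meas.
  apply: measurable_funM; first by meas.
  apply: (measurable_fun_snd (f := fun y => (fine (marginalY X muX dens y))^-1)%R).
  exact: measurable_fun_inv_ge0.
- apply: measurable_funM; first by meas.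
  apply: measurable_funM; first by meas.
  apply: (measurable_fun_fst (f := fun x => (fine (marginalX Y muY dens x))^-1)%R).
  exact: measurable_fun_inv_ge0.
- by rewrite /cut_dens; meas.
- by rewrite /cut_marginalX; meas.
- by rewrite /cut_marginalY; meas.
- by move=> z; rewrite mulr_ge0// divr_ge0.
- by move=> z; rewrite mulr_ge0// divr_ge0.
- by move=> x; rewrite mulr_ge0.
- by move=> y; rewrite mulr_ge0.
- move=> x y; rewrite /cut_condY /cut_marginalX /cut_dens /condY /= !indicE.
  have [Xx|Xx] := boolP (x \in X); last by rewrite !mul0r mulr0.
  have /andP[m0 my] := marginalX_gt0 (set_mem Xx).
  by field; rewrite gt_eqF// fine_gt0// m0.
- move=> x y; rewrite /cut_condX /cut_marginalY /cut_dens /condX /= !indicE.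
  have [Yy|Yy] := boolP (y \in Y); last by rewrite !mul0r !mulr0 mul0r.
  have /andP[m0 my] := marginalY_gt0 (set_mem Yy).
  by field; rewrite gt_eqF// fine_gt0// m0.
- by move=> y; apply: integral_normalized_le1 => //; meas.
- by move=> x; apply: integral_normalized_le1 => //; meas.
- by move=> y Yy; apply: integral_normalized_eq1 => //; [meas|exact: marginalY_gt0].
- by move=> x Xx; apply: integral_normalized_eq1 => //; [meas|exact: marginalX_gt0].
- by move=> x y Xx; rewrite /cut_condX indicE memNset// mul0r.
- by move=> x y Yy; rewrite /cut_condY indicE memNset// mul0r.
- by move=> x Xx; rewrite /cut_marginalX indicE memNset// mul0r.
- by move=> y Yy; rewrite /cut_marginalY indicE memNset// mul0r.
Qed.

Local Notation cd := gibbs_conditional_densities.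

(** An equality of transition functions: integrals, norm and iterates of [PX] are thereby those of
    [KX], which carries a measure structure. *)
Lemma PX_KX : PX X Y muX muY dens = (fun x => KX cd x : set T1 -> \bar R).
Proof.
apply/funext => x; apply/funext => A; rewrite /PX /KX /= /mdens.
rewrite integral_mkcondr; apply: eq_integral => x' _; rewrite patchE /rhoX /kX.
case: ifPn => Xx'; last first.
  move: Xx'; rewrite notin_setE => Xx'.
  under eq_integral do rewrite (cd_c1_out cd _ Xx') mul0r.
  by rewrite integral0.
rewrite integral_mkcond; apply: eq_integral => y _.
rewrite patchE /cut_condX /cut_condY /= !indicE Xx' mul1r.
by case: ifPn => _; rewrite ?mul1r ?mul0r ?mulr0.
Qed.

Lemma PDGS_KD : PDGS X Y muX muY dens = (fun z => KD cd z : set (T1 * T2) -> \bar R).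
Proof.
apply/funext => z; apply/funext => A; rewrite /PDGS /KD /= /mdens.
rewrite integral_mkcondr; apply: eq_integral => z' _; rewrite patchE in_setX.
rewrite /cut_condX /cut_condY /= !indicE.
by do 2 case: (_ \in _); rewrite ?mul1r ?mul0r ?mulr0.
Qed.

Lemma PRGS_KR (p1 p2 : {nonneg R}) : (p1%:num + p2%:num = 1)%R ->
  PRGS X Y muX muY dens p1%:num = (fun z => KR cd p1 p2 z : set (T1 * T2) -> \bar R).
Proof.
move=> p12; have p2E : (1 - p1%:num)%R = p2%:num by rewrite -p12 addrAC subrr add0r.
apply/funext => z; apply/funext => A; rewrite /PRGS /KR p2E [RHS]measure_addE.
rewrite /mscale /= /pushforward /mdens.
have EX : \int[muX]_(x in X) (\1_A (x, z.2) * condX X muX dens x z.2)%:E =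
    \int[muX]_(x in (fun x => (x, z.2)) @^-1` A) (cut_condX (x, z.2))%:E.
  rewrite integral_mkcond [RHS]integral_mkcond; apply: eq_integral => x _.
  rewrite !patchE /cut_condX /= !indicE.
  rewrite (_ : (x \in (fun x => (x, z.2)) @^-1` A) = ((x, z.2) \in A)); last first.
    by apply/idP/idP; rewrite !inE.
  by do 2 case: (_ \in _); rewrite ?mul1r ?mul0r ?mulr0.
have EY : \int[muY]_(y in Y) (\1_A (z.1, y) * condY Y muY dens y z.1)%:E =
    \int[muY]_(y in (fun y => (z.1, y)) @^-1` A) (cut_condY (z.1, y))%:E.
  rewrite integral_mkcond [RHS]integral_mkcond; apply: eq_integral => y _.
  rewrite !patchE /cut_condY /= !indicE.
  rewrite (_ : (y \in (fun y => (z.1, y)) @^-1` A) = ((z.1, y) \in A)); last first.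
    by apply/idP/idP; rewrite !inE.
  by do 2 case: (_ \in _); rewrite ?mul1r ?mul0r ?mulr0.
by rewrite EX EY.
Qed.

(** Positive and negative parts are integrated separately, each being measurable in [y] by Tonelli;
    the identity holds for every [y], whatever value the difference takes when both parts are
    infinite. *)
Lemma measurable_cond_mean (h : T1 -> R) : measurable_fun setT h ->
  measurable_fun setT (fun y => fine (cond_mean X muX dens h y)).
Proof.
move=> mh; apply: (measurableT_comp (f := fine)) => //.
have mc := cd_mc1 cd.
pose f (z : T1 * T2) := (h z.1 * cut_condX z)%:E.
have mf : measurable_fun setT f by rewrite /f; meas.
have mfp : measurable_fun setT (fun z => f^\+ z) := measurable_funepos mf.
have mfn : measurable_fun setT (fun z => f^\- z) := measurable_funeneg mf.
rewrite (_ : cond_mean X muX dens h =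
    fun y => \int[muX]_x f^\+ (x, y) - \int[muX]_x f^\- (x, y)).
  apply: emeasurable_funB.
    apply: (@measurable_integral_snd _ _ _ _ _ muX (fun y x => f^\+ (x, y))).
      by move=> y x; exact: funepos_ge0.
    exact: (measurable_fun_swap mfp).
  apply: (@measurable_integral_snd _ _ _ _ _ muX (fun y x => f^\- (x, y))).
    by move=> y x; exact: funeneg_ge0.
  exact: (measurable_fun_swap mfn).
apply/funext => y.
transitivity (\int[muX]_x f (x, y)); last first.
  rewrite [LHS]integralE.
  by congr (_ - _); apply: eq_integral => x _; rewrite ?funeposE ?funenegE.
rewrite /cond_mean integral_mkcond; apply: eq_integral => x _.
rewrite patchE /f /cut_condX /= indicE.
by case: ifPn => _; rewrite ?mul1r ?mul0r ?mulr0.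
Qed.

(** Integrating a function of [y] against [w] brings in the weight [beta y], which turns the
    conditional density into the joint one. *)
Lemma integral_cond_var (w : probability (T1 * T2)%type R) (h : T1 -> R) :
  (forall A, measurable A -> w A = \int[muX \x muY]_(z in A) (cut_dens z)%:E) ->
  measurable_fun setT h ->
  \int[w]_z cond_var X muX dens h z.2 =
  joint_variance muX muY cut_dens h (fun y => fine (cond_mean X muX dens h y)).
Proof.
move=> wE mh; set m := fun y => fine _; have mm : measurable_fun setT m.
  exact: measurable_cond_mean.
have mc := cd_mc1 cd; have c0 := cd_c1_ge0 cd.
have cvE y : cond_var X muX dens h y = \int[muX]_x ((h x - m y) ^+ 2 * cut_condX (x, y))%:E.
  rewrite /cond_var integral_mkcond; apply: eq_integral => x _.
  rewrite patchE /cut_condX /= indicE.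
  by case: ifPn => _; rewrite ?mul1r ?mul0r ?mulr0.
have cv0 y : 0 <= cond_var X muX dens h y.
  by rewrite cvE; apply: integral_ge0 => x _; rewrite lee_fin mulr_ge0 ?sqr_ge0.
have mcv : measurable_fun setT (cond_var X muX dens h).
  rewrite (funext cvE).
  apply: (@measurable_integral_snd _ _ _ _ _ muX
    (fun y x => ((h x - m y) ^+ 2 * cut_condX (x, y))%:E)); last by meas.
  by move=> y x; rewrite lee_fin mulr_ge0 ?sqr_ge0.
rewrite (integral_joint_snd cd wE cv0 mcv); apply: eq_integral => y _.
have b0 := cd_beta_ge0 cd y; rewrite cvE -ge0_integralZr//; last 2 first.
- by meas.
- by move=> x _; rewrite lee_fin mulr_ge0 ?sqr_ge0.
by apply: eq_integral => x _; rewrite -!EFinM -mulrA (cd_c1_beta cd).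
Qed.

End gibbs_densities.

(** If every term exceeded [e], all tail infima, and with them the limit inferior, would be at least
    [e]. *)
Lemma limn_einf0_small (R : realType) (u : (\bar R)^nat) (e : R) :
  limn_einf u = 0 -> (0 < e)%R -> exists n, u n <= e%:E.
Proof.
move=> u0 e0; apply: contrapT => /forallNP ue.
suff : e%:E <= 0 by rewrite leNgt lte_fin e0.
rewrite -u0 limn_einf_lim; apply: lime_ge; first exact: is_cvg_einfs.
apply: nearW => n; apply: le_ereal_inf_tmp => _ [k /= _ <-].
by apply/ltW; rewrite ltNge; apply/negP; exact: ue.
Qed.

(** The support condition is encoded as measurable [X] and [Y] whose product has mass 1, and
    well-definedness of the conditional densities as marginals in ]0, +oo[ on [X] and [Y]. *)
Theorem proposition2 (R : realType) (k l : nat)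
  (k_ge1 : (1 <= k)%N) (l_ge1 : (1 <= l)%N)
  (X : set (k.-tuple R)) (Y : set (l.-tuple R))
  (mX : measurable X) (mY : measurable Y)
  (muX : {sigma_finite_measure set (k.-tuple R) -> \bar R})
  (muY : {sigma_finite_measure set (l.-tuple R) -> \bar R})
  (dens : k.-tuple R * l.-tuple R -> R)
  (dens_meas : measurable_fun setT dens)
  (dens_ge0 : forall z, (0 <= dens z)%R)
  (varpi : probability (k.-tuple R * l.-tuple R)%type R)
  (varpi_density : forall A, measurable A ->
    varpi A = \int[muX \x muY]_(z in A) (dens z)%:E)
  (varpi_support : varpi (X `*` Y) = 1)
  (marginalX_gt0 : forall x, X x -> 0 < marginalX Y muY dens x < +oo)
  (marginalY_gt0 : forall y, Y y -> 0 < marginalY X muX dens y < +oo)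
  (p : R) (p01 : (0 < p < 1)%R)
  (h : nat -> k.-tuple R -> R)
  (hL2 : forall i, L2_01 (distribution varpi fst) (h i))
  (hvar : limn_einf
    (fun i => \int[varpi]_z cond_var X muX dens (h i) z.2) = 0) :
  [/\ kernel_norm (distribution varpi fst) (PX X Y muX muY dens) = 1,
      kernel_norm varpi (PRGS X Y muX muY dens p) = 1,
      subgeometrically_ergodic X (distribution varpi fst)
        (PX X Y muX muY dens),
      subgeometrically_ergodic (X `*` Y) varpi (PRGS X Y muX muY dens p) &
      subgeometrically_ergodic (X `*` Y) varpi (PDGS X Y muX muY dens)].
Proof.
pose cd := gibbs_conditional_densities mX mY dens_meas dens_ge0 marginalX_gt0 marginalY_gt0.
have mXY : measurable (X `*` Y) by exact: measurableX.
(* [dens] may be nonzero outside the product of [X] and [Y], but [varpi] has no mass there, so the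
   cut-off density describes the same probability. *)
have wE A : measurable A ->
    varpi A = \int[muX \x muY]_(z in A) (cut_dens X Y dens z)%:E.
  move=> mA; have mAXY := measurableI _ _ mA mXY.
  have XYC0 : varpi (~` (X `*` Y)) = 0 by rewrite probability_setC// varpi_support subee.
  have AD0 : varpi (A `\` X `*` Y) = 0.
    apply: subset_measure0 XYC0; [exact: measurableD|exact: measurableC|by move=> z []].
  have -> : varpi A = varpi (A `&` (X `*` Y)).
    by rewrite (measureDI varpi mA mXY) [X in X + _]AD0 add0e.
  rewrite varpi_density// integral_mkcondr; apply: eq_integral => z _.
  rewrite patchE in_setX /cut_dens !indicE.
  by do 2 case: (_ \in _); rewrite ?mul1r ?mul0r ?mulr0.
have small e : (0 < e)%R -> exists f m, [/\ L2_01 (distribution varpi fst) f,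
    measurable_fun setT m & joint_variance muX muY (cut_dens X Y dens) f m <= e%:E].
  move=> e0; have [i hi] := limn_einf0_small hvar e0; have [mh _] := L2_01P (hL2 i).
  exists (h i), (fun y => fine (cond_mean X muX dens (h i) y)); split => //.
    exact (measurable_cond_mean mX mY dens_meas dens_ge0 marginalX_gt0 marginalY_gt0 mh).
  by rewrite -(integral_cond_var mX mY dens_meas dens_ge0 marginalX_gt0 marginalY_gt0 wE mh).
have [p0 p1] := andP p01.
have p_ge0 := ltW p0; have q_ge0 : (0 <= 1 - p)%R by rewrite subr_ge0 ltW.
have p12 : ((NngNum p_ge0)%:num + (NngNum q_ge0)%:num = 1)%R by rewrite /= addrC subrK.
rewrite (PX_KX mX mY dens_meas dens_ge0 marginalX_gt0 marginalY_gt0).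
rewrite (PDGS_KD mX mY dens_meas dens_ge0 marginalX_gt0 marginalY_gt0).
rewrite (PRGS_KR mX mY dens_meas dens_ge0 marginalX_gt0 marginalY_gt0 p12).
split.
- exact (kernel_norm_KX cd wE varpi_support small).
- exact (kernel_norm_KR cd wE varpi_support small p12).
- exact (subgeometric_KX (cd := cd) wE varpi_support small).
- exact (subgeometric_KR (cd := cd) wE varpi_support small p12).
- exact (subgeometric_KD (cd := cd) wE varpi_support small).
Qed.
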